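(* Let $\hat x:\mathrm{M}^2\to\mathbb{S}^3$ be an immersed surface with no umbilical point. Then $\hat x$ is a Willmore surface in $\mathbb{S}^3$ if and only if the associate 4-surface $\tilde x$ of $\hat x$ in $\mathbb{R}^{1,4}$ is minimal.
   Context: $\mathbb{R}^{1,4}=\{(t,x):t\in\mathbb{R},x\in\mathbb{R}^4\}$ with $\langle(t,x),(s,y)\rangle=-st+x\cdot y$; $\mathbb{N}^4_+=\{(t,x):-t^2+|x|^2=0,\ t>0\}$; $\mathbb{S}^{1,3}=\{(t,x):-t^2+|x|^2=1\}$. $\mathbb{S}^3\subset\mathbb{R}^4$ is the unit sphere with round metric. All maps are smooth. For an immersed surface $\hat x:\mathrm{M}^2\to\mathbb{S}^3\subset\mathbb{R}^4$ with unit normal ${\bf n}$ (tangent to $\mathbb{S}^3$) and local isothermal coordinates $(u^1,u^2)$: $I=\langle d\hat x,d\hat x\rangle$, $II=-\langle d\hat x,d{\bf n}\rangle$, $H=\frac12\mathrm{tr}_I II$, $\overset{\circ}{II}=II-HI$; a point is umbilical if $\overset{\circ}{II}=0$ there. $\hat x$ is a Willmore surface if $\Delta H+|\overset{\circ}{II}|^2H=0$, with $\Delta$ and the norm taken with respect to $I$. The conformal Gauss map is $\xi=Hy+(0,{\bf n}):\mathrm{M}^2\to\mathbb{S}^{1,3}$, where $y=(1,\hat x)$. When $\hat x$ has no umbilical point, $\xi$ is a spacelike immersion and there is a unique $y^*:\mathrm{M}^2\to\mathbb{N}^4_+$ with $\langle y^*,y\rangle=-1$, $\langle y^*,y^*\rangle=0$,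 $\langle y^*,\xi\rangle=0$, $\langle y^*,\xi_{u^1}\rangle=\langle y^*,\xi_{u^2}\rangle=0$. The associate 4-surface of $\hat x$ is $$\tilde x=\alpha y+\alpha\rho y^*:\mathbb{R}^+\times\mathbb{R}^+\times\mathrm{M}^2\to\mathbb{R}^{1,4},\qquad(\alpha,\rho)\in\mathbb{R}^+\times\mathbb{R}^+ .$$ $\xi$ is a unit normal to $\tilde x$. The fundamental forms of $\tilde x$ are $I^{\tilde x}=\langle d\tilde x,d\tilde x\rangle$ and $II^{\tilde x}=-\langle d\tilde x,d\xi\rangle$, its mean curvature is $H^{\tilde x}=\mathrm{Tr}\big((I^{\tilde x})^{-1}II^{\tilde x}\big)$, and $\tilde x$ is minimal if $H^{\tilde x}$ vanishes identically wherever $I^{\tilde x}$ is nondegenerate. *)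

(* Defs.v *)
From HB Require Import structures.
From mathcomp Require Import all_boot all_order all_algebra.
From mathcomp Require Import all_classical all_reals all_analysis.
Set Implicit Arguments.
Unset Strict Implicit.
Unset Printing Implicit Defensive.
Import Order.TTheory GRing.Theory Num.Theory.
Import numFieldNormedType.Exports.
Local Open Scope classical_set_scope.
Local Open Scope ring_scope.

Section LocalCalculus.
Context {R : realType}.

Definition partial (m : nat) (V : normedModType R) (k : 'I_m)
    (f : 'rV[R]_m -> V) (u : 'rV[R]_m) : V :=
  'D_(delta_mx 0 k) f u.

Fixpoint Ck_on (r m : nat) (V : normedModType R)
    (U : set 'rV[R]_m) (f : 'rV[R]_m -> V) : Prop :=
  match r with
  | 0%N => forall u, U u -> {for u, continuous f}
  | s.+1 => (forall u, U u -> differentiable f u) /\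
            (forall k : 'I_m, Ck_on s U (partial k f))
  end.

(* Only used for open [U]; values of [f] outside [U] are irrelevant. *)
Definition smooth_on (m : nat) (V : normedModType R)
    (U : set 'rV[R]_m) (f : 'rV[R]_m -> V) : Prop :=
  forall r : nat, Ck_on r U f.

(* <df, df> for a scalar product [B] on the target, in coordinates. *)
Definition first_form (m : nat) (V : normedModType R) (B : V -> V -> R)
    (f : 'rV[R]_m -> V) (u : 'rV[R]_m) : 'M[R]_m :=
  \matrix_(i, j) B (partial i f u) (partial j f u).

(* - <df, dnu>, where [nu] is a normal field along [f]. *)
Definition second_form (m : nat) (V : normedModType R) (B : V -> V -> R)
    (f nu : 'rV[R]_m -> V) (u : 'rV[R]_m) : 'M[R]_m :=
  \matrix_(i, j) - B (partial i f u) (partial j nu u).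

(* |T|^2 = g^{ij} g^{kl} T_{ik} T_{jl} *)
Definition tensor_norm2 (m : nat) (g T : 'M[R]_m) : R :=
  \tr (invmx g *m T *m invmx g *m T^T).

(* Laplace-Beltrami operator of the metric [g], in arbitrary coordinates. *)
Definition laplace_beltrami (m : nat) (g : 'rV[R]_m -> 'M[R]_m)
    (f : 'rV[R]_m -> R^o) (u : 'rV[R]_m) : R :=
  (Num.sqrt (\det (g u)))^-1 *
  \sum_(i < m) partial i
    (fun v : 'rV[R]_m => Num.sqrt (\det (g v)) *
       \sum_(j < m) invmx (g v) i j * partial j f v : R^o) u.

End LocalCalculus.

(* Smooth 2-manifolds without boundary, not necessarily connected or oriented.
   The atlas consists of local parametrizations [param i : dom i -> spt] with
   inverse [coord i]; both are total functions, meaningful only on [dom i] and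
   on its image respectively.  [chart_at] selects a chart around each point. *)
Record surface (R : realType) := Surface {
  spt :> topologicalType;
  surface_hausdorff : hausdorff_space spt;
  surface_second_countable : @second_countable spt;
  chart : Type;
  dom : chart -> set 'rV[R]_2;
  param : chart -> 'rV[R]_2 -> spt;
  coord : chart -> spt -> 'rV[R]_2;
  chart_at : spt -> chart;
  open_dom : forall i, open (dom i);
  open_param : forall i, open (param i @` dom i);
  paramK : forall i u, dom i u -> coord i (param i u) = u;
  param_continuous : forall i u, dom i u -> {for u, continuous (param i)};
  coord_continuous :
    forall i p, (param i @` dom i) p -> {for p, continuous (coord i)};
  chart_at_cover : forall p, (param (chart_at p) @` dom (chart_at p)) p;
  smooth_transition : forall i j,
    smooth_on (dom i `&` param i @^-1` (param j @` dom j)) (coord j \o param i)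
}.

Section Surfaces.
Context {R : realType}.

Definition dot (v w : 'rV[R]_4) : R := (v *m w^T) 0 0.

(* R^{1,4}, with points written (t, x). *)
Definition R14 : normedModType R := (R^o * 'rV[R]_4)%type.

Definition lorentz (v w : R14) : R := - (v.1 * w.1) + dot v.2 w.2.

Definition light_cone : set R14 := [set v | lorentz v v = 0 /\ 0 < v.1].

Variable M : surface R.

Definition smooth_map (V : normedModType R) (f : M -> V) : Prop :=
  forall i, smooth_on (dom i) (f \o param i).

Definition immersion_S3 (x : M -> 'rV[R]_4) : Prop :=
  [/\ smooth_map x,
      forall p, dot (x p) (x p) = 1 &
      forall i u, dom i u -> injective ('d (x \o @param R M i) u)].

Definition unit_normal (x n : M -> 'rV[R]_4) : Prop :=
  [/\ smooth_map n,
      forall p, dot (n p) (n p) = 1,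
      forall p, dot (n p) (x p) = 0 &
      forall i u k, dom i u ->
        dot (n (param i u)) (partial k (x \o @param R M i) u) = 0].

Section Immersed.
Variables x n : M -> 'rV[R]_4.

Definition surf_I (i : chart M) : 'rV[R]_2 -> 'M[R]_2 :=
  first_form dot (x \o @param R M i).

Definition surf_II (i : chart M) : 'rV[R]_2 -> 'M[R]_2 :=
  second_form dot (x \o @param R M i) (n \o @param R M i).

(* The trace does not depend on the chart in which it is computed. *)
Definition surf_H (p : M) : R^o :=
  let i := chart_at p in let u := coord i p in
  2^-1 * \tr (invmx (surf_I i u) *m surf_II i u).

Definition surf_IIo (i : chart M) (u : 'rV[R]_2) : 'M[R]_2 :=
  surf_II i u - surf_H (param i u) *: surf_I i u.

(* Vanishing of a tensor in one chart amounts to its vanishing in every chart. *)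
Definition umbilical (p : M) : Prop :=
  exists i, (param i @` dom i) p /\ surf_IIo i (coord i p) = 0.

Definition willmore : Prop := forall i u, dom i u ->
  laplace_beltrami (surf_I i) (surf_H \o @param R M i) u
  + tensor_norm2 (surf_I i u) (surf_IIo i u) * surf_H (param i u) = 0.

Definition lightlift (p : M) : R14 := (1, x p).

Definition gauss_map (p : M) : R14 :=
  surf_H p *: lightlift p + ((0, n p) : R14).

(* The conditions that single out y^*(p). *)
Definition dual_vectors (p : M) : set R14 :=
  [set v | [/\ light_cone v,
               lorentz v (lightlift p) = -1,
               lorentz v (gauss_map p) = 0 &
               forall i u k, dom i u -> param i u = p ->
                 lorentz v (partial k (gauss_map \o @param R M i) u) = 0]].

(* y^*: the unique element of [dual_vectors p] in the absence of umbilical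
   points. *)
Definition dual_lift (p : M) : R14 := xget 0 (dual_vectors p).

Definition associate_surface (alpha rho : R) (p : M) : R14 :=
  alpha *: lightlift p + (alpha * rho) *: dual_lift p.

End Immersed.

(* Expression of a map on R x R x M in the coordinates
   (alpha, rho, u^1, u^2) associated with the chart [i]. *)
Definition in_chart4 (V : Type) (i : chart M) (f : R -> R -> M -> V)
    (w : 'rV[R]_(2 + 2)) : V :=
  f (lsubmx w 0 0) (lsubmx w 0 1) (param i (rsubmx w)).

(* [nu] is a unit normal field along [X : R^+ x R^+ x M -> R^{1,4}]. *)
Definition minimal4 (X nu : R -> R -> M -> R14) : Prop :=
  forall (i : chart M) (w : 'rV[R]_(2 + 2)),
  0 < lsubmx w 0 0 -> 0 < lsubmx w 0 1 -> dom i (rsubmx w) ->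
  let g := first_form lorentz (in_chart4 i X) w in
  let h := second_form lorentz (in_chart4 i X) (in_chart4 i nu) w in
  g \in unitmx -> \tr (invmx g *m h) = 0.

Definition associate_minimal (x n : M -> 'rV[R]_4) : Prop :=
  minimal4 (associate_surface x n) (fun _ _ p => gauss_map x n p).

End Surfaces.

(* Main.v *)
Require Import Defs.
From HB Require Import structures.
From mathcomp Require Import all_boot all_order all_algebra.
From mathcomp Require Import all_classical all_reals all_analysis.
From mathcomp Require Import ring.
Set Implicit Arguments.
Unset Strict Implicit.
Unset Printing Implicit Defensive.
Import Order.TTheory GRing.Theory Num.Theory.
Import numFieldNormedType.Exports.
Local Open Scope classical_set_scope.
Local Open Scope ring_scope.

(* In a chart put Z_k = d_k xi - (d_k H) y = H x_k + n_k, so that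
   Z_k . x_l = - IIo_kl.  The conformal Gauss map is conformal,
   <xi_k, xi_l> = lambda I_kl with lambda = |IIo|^2 / 2, and y, y*, xi, xi_1, xi_2
   is a frame of R^{1,4}.  Expanding the tangent vectors of the 4-surface in this
   frame makes its first form T Q T^T with T block triangular, and its mean
   curvature a nonzero multiple of tr_I C, where
   C_kl = <y_k + rho y*_k, xi_l> = - IIo_kl + rho <y*_k, xi_l>.
   The first term is trace-free.  For the second, differentiating
   <y*, xi_l> = 0 and using the Codazzi equations gives
   tr_I <y*_k, xi_l> = Delta H + |IIo|^2 H.  As det IIo <> 0, the first form is
   nondegenerate for some rho > 0, which yields the converse. *)

(** * Partial derivatives and smoothness *)

(** Coordinates are arbitrary. With [G = sqrt (det g) g^-1] the Laplacian has divergence form, and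
    the Codazzi equations reduce to the cancellation of second derivatives in [d_k Z_l - d_l Z_k],
    so plain partial derivatives suffice. The obstacle is y*: [dual_lift] selects it separately at
    each point, which says nothing about its derivatives. It is therefore rebuilt by an explicit
    smooth formula whose tangential part solves [P a = dh] with [P = - IIo]. The absence of umbilics
    makes [P] invertible, and uniqueness identifies the formula with [dual_lift]. Moving the
    derivative from y* to xi_l keeps the derivatives of [a] out of the computation. The mean
    curvature first appears as a trace containing the inverse of [C]. That it is a multiple of tr_I
    C is special to 2 by 2 matrices, where the trace of the inverse is the trace divided by the
    determinant. *)

Section Partial.
Context {R : realType} {m : nat}.
Implicit Types (V W : normedModType R) (u : 'rV[R]_m) (k : 'I_m).

Lemma partialE V (f : 'rV[R]_m -> V) k u :
  differentiable f u -> partial k f u = 'd f u (delta_mx 0 k).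
Proof. exact: deriveE. Qed.

Lemma near_eq_partial V (f g : 'rV[R]_m -> V) k u :
  {near u, f =1 g} -> partial k f u = partial k g u.
Proof. exact: near_eq_derive. Qed.

Lemma differentiable_littleo V W (f : V -> W) (u : V) : differentiable f u ->
  forall e : R, 0 < e ->
  \forall h \near 0, `|f (h + u) - f u - 'd f u h| <= e * `|h|.
Proof.
move=> /diff_locally /eqaddoP fE e e0; have := fE _ e0.
apply: filterS => h /=; rewrite -[X in `|X| <= _]/(f (h + u) - (f u + 'd f u h)).
by rewrite opprD addrA.
Qed.

(** The first order expansion of [f] at [u] is also one of [g], and [diff_unique] then identifies
    the two differentials. *)
Lemma near_eq_differentiable V W (f g : V -> W) (u : V) :
  {near u, f =1 g} -> differentiable f u -> differentiable g u.
Proof.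
move=> fg df.
have gE : g \o shift u = cst (g u) + 'd f u +o_ 0 id.
  apply/eqaddoE/eqaddoP => e e0.
  have := differentiable_littleo df e0.
  have fgu : f u = g u by exact: nbhs_singleton fg.
  move: fg; rewrite (near_shift 0) subr0 => fg.
  apply: filterS2 fg => h /= fgh.
  rewrite -[X in _ -> `|X| <= _]/(g (h + u) - (g u + 'd f u h)).
  by rewrite opprD addrA -fgh -fgu.
have dE := diff_unique (diff_continuous df) gE.
apply/diff_locallyP; split; last by rewrite dE.
by rewrite dE; exact: diff_continuous.
Qed.

Lemma partial_cst V (a : V) k u : partial k (fun=> a) u = 0.
Proof. exact: derive_cst. Qed.

Lemma partialD V (f g : 'rV[R]_m -> V) k u :
  differentiable f u -> differentiable g u ->
  partial k (fun v => f v + g v) u = partial k f u + partial k g u.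
Proof. by move=> df dg; apply: deriveD; exact: diff_derivable. Qed.

Lemma partialN V (f : 'rV[R]_m -> V) k u :
  differentiable f u -> partial k (fun v => - f v) u = - partial k f u.
Proof. by move=> df; apply: deriveN; exact: diff_derivable. Qed.

Lemma partial_coord n (f : 'rV[R]_m -> 'rV[R]_n) c k u : differentiable f u ->
  partial k (fun v => f v 0 c : R^o) u = partial k f u 0 c.
Proof.
by move=> df; rewrite /partial derive_mx ?mxE//; exact: diff_derivable.
Qed.

Lemma partial_pair V W (f : 'rV[R]_m -> V) (g : 'rV[R]_m -> W) k u :
  differentiable f u -> differentiable g u ->
  partial k (fun v => (f v, g v)) u = (partial k f u, partial k g u).
Proof.
move=> df dg; rewrite !partialE ?diff_pair//.
exact: differentiable_pair.
Qed.

Section Bilinear.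
Context (U V W : normedModType R) (B : U -> V -> W).

(** A bare predicate, so that scalar multiplication, [dot] and [lorentz] share one Leibniz rule and
    one smoothness lemma; the bilinear structure is packed locally from it. *)
Definition continuous_bilinear : Prop :=
  bilinear_for (GRing.Scale.Law.clone _ _ *:%R _)
               (GRing.Scale.Law.clone _ _ *:%R _) B /\
  continuous (fun p : U * V => B p.1 p.2).

Hypothesis B_bilinear : continuous_bilinear.

Let Bbuild := bilinear_isBilinear.Build R U V W _ _ B B_bilinear.1.
Let BB : {bilinear U -> V -> W} := HB.pack B Bbuild.

Lemma differentiable_bilinear (T : normedModType R) (f : T -> U) (g : T -> V)
    (u : T) : differentiable f u -> differentiable g u ->
  differentiable (fun v => B (f v) (g v)) u.
Proof.
move=> df dg.
have := @differentiable_bilin _ _ _ _ BB (f u, g u) B_bilinear.2.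
apply: (@differentiable_comp _ _ _ _ (fun v => (f v, g v))).
exact: differentiable_pair.
Qed.

Lemma partial_bilinear (f : 'rV[R]_m -> U) (g : 'rV[R]_m -> V) k u :
  differentiable f u -> differentiable g u ->
  partial k (fun v => B (f v) (g v)) u =
  B (partial k f u) (g u) + B (f u) (partial k g u).
Proof.
move=> df dg.
have dB := @differentiable_bilin _ _ _ _ BB (f u, g u) B_bilinear.2.
rewrite !partialE//; last exact: differentiable_bilinear.
have dfg : differentiable (fun v => (f v, g v)) u by exact: differentiable_pair.
have -> : (fun v => B (f v) (g v)) = (fun q => BB q.1 q.2) \o (fun v => (f v, g v)).
  by [].
rewrite diff_comp// diff_bilin//=; last exact: B_bilinear.2.
by rewrite diff_pair//= addrC.
Qed.

End Bilinear.

Lemma scale_bilinear V :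
  continuous_bilinear (fun (a : R^o) (v : V) => a *: v).
Proof.
split; last by move=> p; apply: cvgZ; [exact: cvg_fst|exact: cvg_snd].
split=> [v|a] b x y /=; first by rewrite scalerDl scalerA.
by rewrite scalerDr scalerA mulrC -scalerA.
Qed.

Lemma differentiable_scale (T : normedModType R) V (f : T -> R^o) (g : T -> V)
    (u : T) : differentiable f u -> differentiable g u ->
  differentiable (fun v => f v *: g v) u.
Proof. exact: (differentiable_bilinear (scale_bilinear V)). Qed.

Lemma partial_scale V (f : 'rV[R]_m -> R^o) (g : 'rV[R]_m -> V) k u :
  differentiable f u -> differentiable g u ->
  partial k (fun v => f v *: g v) u = partial k f u *: g u + f u *: partial k g u.
Proof. exact: (partial_bilinear (scale_bilinear V)). Qed.

Lemma differentiable_mul (T : normedModType R) (f g : T -> R^o)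
    (u : T) : differentiable f u -> differentiable g u ->
  differentiable (fun v => f v * g v : R^o) u.
Proof. exact: differentiable_scale. Qed.

Lemma partial_mul (f g : 'rV[R]_m -> R^o) k u :
  differentiable f u -> differentiable g u ->
  partial k (fun v => f v * g v : R^o) u = partial k f u * g u + f u * partial k g u.
Proof. exact: partial_scale. Qed.

Lemma partial_inv (f : 'rV[R]_m -> R^o) k u : differentiable f u -> f u != 0 ->
  partial k (fun v => (f v)^-1 : R^o) u = - partial k f u * ((f u)^-1 * (f u)^-1).
Proof.
move=> df fu0; rewrite !partialE//; last exact: differentiableV.
rewrite diffV//= -invfM -expr2 mulNr mulrC.
by rewrite -[LHS]/(- _ * _) mulNr.
Qed.

End Partial.

Section Smooth.
Context {R : realType} {m : nat} {U : set 'rV[R]_m}.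
Hypothesis U_open : open U.
Implicit Types (V W : normedModType R) (r : nat) (u : 'rV[R]_m) (k : 'I_m).

Lemma nbhs_open u : U u -> nbhs u U.
Proof. by move=> Uu; exact: open_nbhs_nbhs. Qed.

Lemma Ck_on_ext V r (f g : 'rV[R]_m -> V) :
  (forall u, U u -> f u = g u) -> Ck_on r U f -> Ck_on r U g.
Proof.
have near_fg (f' g' : 'rV[R]_m -> V) u : U u ->
    (forall u, U u -> f' u = g' u) -> {near u, f' =1 g'}.
  by move=> Uu fg; apply: filterS (nbhs_open Uu) => v; exact: fg.
elim: r f g => [|r IH] f g fg /=.
  move=> cf u Uu; have fu := cf u Uu; rewrite /prop_for /= in fu *.
  have := near_fg _ _ _ Uu fg.
  rewrite /continuous_at -fg// => /near_eq_cvg h.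
  exact: cvg_trans h fu.
move=> [df pf]; split=> [u Uu|k].
  exact: near_eq_differentiable (near_fg _ _ _ Uu fg) (df u Uu).
by apply: IH (pf k) => u Uu; apply: near_eq_partial; exact: near_fg.
Qed.

Lemma Ck_onW V r (f : 'rV[R]_m -> V) : Ck_on r.+1 U f -> Ck_on r U f.
Proof.
elim: r f => [|r IH] f [df pf].
  by move=> u /df; exact: differentiable_continuous.
by split=> // k; exact: IH (pf k).
Qed.

Lemma smooth_differentiable V (f : 'rV[R]_m -> V) u :
  smooth_on U f -> U u -> differentiable f u.
Proof. by move=> /(_ 1%N)[df _] /df. Qed.

Lemma smooth_partial V (f : 'rV[R]_m -> V) k :
  smooth_on U f -> smooth_on U (partial k f).
Proof. by move=> sf r; have [_] := sf r.+1; apply. Qed.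

Lemma smooth_ext V (f g : 'rV[R]_m -> V) :
  (forall u, U u -> f u = g u) -> smooth_on U f -> smooth_on U g.
Proof. by move=> fg sf r; exact: Ck_on_ext fg (sf r). Qed.

Lemma smooth_cst V (a : V) : smooth_on U (fun=> a).
Proof.
move=> r; elim: r a => [|r IH] a; first by move=> u _; exact: (@cst_continuous _ _ a).
split=> [u _|k]; first exact: differentiable_cst.
by apply: Ck_on_ext (IH 0) => u _; rewrite partial_cst.
Qed.

Lemma Ck_on_add V r (f g : 'rV[R]_m -> V) :
  Ck_on r U f -> Ck_on r U g -> Ck_on r U (fun v => f v + g v).
Proof.
elim: r f g => [|r IH] f g.
  by move=> cf cg u Uu; exact: cvgD (cf u Uu) (cg u Uu).
move=> [df pf] [dg pg]; split=> [u Uu|k].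
  by apply: differentiableD; [exact: df|exact: dg].
apply: Ck_on_ext (IH _ _ (pf k) (pg k)) => u Uu.
by rewrite partialD//; [exact: df|exact: dg].
Qed.

Lemma Ck_on_bilinear (V1 V2 W : normedModType R) (B : V1 -> V2 -> W) r
    (f : 'rV[R]_m -> V1) (g : 'rV[R]_m -> V2) : continuous_bilinear B ->
  Ck_on r U f -> Ck_on r U g -> Ck_on r U (fun v => B (f v) (g v)).
Proof.
move=> bB; elim: r f g => [|r IH] f g.
  move=> cf cg u Uu.
  apply: (@cvg_comp _ _ _ (fun v => (f v, g v)) (fun p => B p.1 p.2) _ (nbhs (f
    u, g u))).
    exact: cvg_pair (cf u Uu) (cg u Uu).
  exact: (bB.2 (f u, g u)).
move=> Cf Cg; have [[df pf] [dg pg]] := (Cf, Cg); split=> [u Uu|k].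
  by apply: differentiable_bilinear => //; [exact: df|exact: dg].
(* Each term of the Leibniz rule keeps one factor undifferentiated; [Ck_onW] lowers its class to [r]
   so that the induction hypothesis applies. *)
apply: Ck_on_ext (Ck_on_add (IH _ _ (pf k) (Ck_onW Cg)) (IH _ _ (Ck_onW Cf) (pg k))).
by move=> u Uu; rewrite partial_bilinear//; [exact: df|exact: dg].
Qed.

Lemma smooth_add V (f g : 'rV[R]_m -> V) :
  smooth_on U f -> smooth_on U g -> smooth_on U (fun v => f v + g v).
Proof. by move=> sf sg r; exact: Ck_on_add. Qed.

Lemma smooth_bilinear (V1 V2 W : normedModType R) (B : V1 -> V2 -> W)
    (f : 'rV[R]_m -> V1) (g : 'rV[R]_m -> V2) : continuous_bilinear B ->
  smooth_on U f -> smooth_on U g -> smooth_on U (fun v => B (f v) (g v)).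
Proof. by move=> bB sf sg r; exact: Ck_on_bilinear. Qed.

Lemma smooth_mul (f g : 'rV[R]_m -> R^o) :
  smooth_on U f -> smooth_on U g -> smooth_on U (fun v => f v * g v : R^o).
Proof. exact: smooth_bilinear (scale_bilinear _). Qed.

Lemma smooth_opp (f : 'rV[R]_m -> R^o) :
  smooth_on U f -> smooth_on U (fun v => - f v : R^o).
Proof.
move=> sf; apply: smooth_ext (smooth_mul (smooth_cst (-1 : R^o)) sf) => u _.
by rewrite mulN1r.
Qed.

Lemma smooth_inv (f : 'rV[R]_m -> R^o) : (forall u, U u -> f u != 0) ->
  smooth_on U f -> smooth_on U (fun v => (f v)^-1 : R^o).
Proof.
move=> f0 sf r; elim: r => [|r IH].
  move=> u Uu; apply: differentiable_continuous; apply: differentiableV.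
    exact: smooth_differentiable Uu.
  exact: f0.
split=> [u Uu|k].
  by apply: differentiableV; [exact: smooth_differentiable Uu|exact: f0].
(* The derivative [- f' * (f^-1 * f^-1)] contains the inverse only undifferentiated, hence of class
   [r] by induction. *)
apply: (Ck_on_ext _ (Ck_on_bilinear (scale_bilinear _)
  (smooth_opp (smooth_partial k sf) r)
  (Ck_on_bilinear (scale_bilinear _) IH IH))) => u Uu.
by rewrite partial_inv//; [exact: smooth_differentiable Uu|exact: f0].
Qed.

End Smooth.

(** * Symmetry of second derivatives *)

Section SecondDerivatives.
Context {R : realType} {m : nat}.

Lemma is_derive_line (V : normedModType R) (f : 'rV[R]_m -> V) a k (t : R) :
  differentiable f (t *: delta_mx 0 k + a) ->
  is_derive t 1 (fun s => f (s *: delta_mx 0 k + a)) (partial k f (t *: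
    delta_mx 0 k + a)).
Proof.
move=> df.
have dg : is_diff t (fun s : R => s *: (delta_mx 0 k : 'rV[R]_m) + a)
    (( *:%R ^~ (delta_mx 0 k)) + 0).
  exact: is_diffD (is_diff_scalel t _) (is_diff_cst a t).
have dfg : differentiable (f \o (fun s : R => s *: delta_mx 0 k + a)) t.
  exact: differentiable_comp.
split; first exact: diff_derivable.
by rewrite deriveE// diff_comp//= diff_val/= -[X in 'd f _ X]/(1 *: _ + 0)
  addr0 scale1r partialE.
Qed.

Definition second_difference (f : 'rV[R]_m -> R) (p q u : 'rV[R]_m) : R :=
  f (p + (q + u)) - f (p + u) - f (q + u) + f u.

(* Mean value theorem in the direction [i], then differentiability of
   [partial i f] at [u]. *)
Lemma second_difference_approx (f : 'rV[R]_m -> R^o) i j u (e : R) : 0 < e ->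
  (\forall v \near u, differentiable f v) -> differentiable (partial i f) u ->
  \forall h \near 0^'+,
    `|second_difference f (h *: delta_mx 0 i) (h *: delta_mx 0 j) u
       - h * h * partial j (partial i f) u| <= e * h * h.
Proof.
move=> e0 df dfi.
pose ei : 'rV[R]_m := delta_mx 0 i; pose ej : 'rV[R]_m := delta_mx 0 j.
(* For [s] and [t] in [[0, h]] the vector [s *: ei + t *: ej] has norm at most [h * C]; the summand
   1 keeps [C] positive. The tolerance [e / (2 * C)] below thus costs [e / 2 * h] at each of the two
   points compared, [e * h] in all. *)
pose C := `|ei| + `|ej| + 1.
have C0 : 0 < C by rewrite ltr_wpDl// addr_ge0.
have /nbhs_ballP[d /= d0 Hd] : \forall w \near (0 : 'rV[R]_m),
    differentiable f (w + u) /\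
    `|partial i f (w + u) - partial i f u - 'd (partial i f) u w|
      <= e / (2 * C) * `|w|.
  have e1 : 0 < e / (2 * C) by rewrite divr_gt0// mulr_gt0.
  have H := differentiable_littleo dfi e1.
  move: df; rewrite (near_shift 0) subr0 => df.
  by apply: filterS2 df H => w /=.
have dC : 0 < d / C by rewrite divr_gt0.
near=> h.
have h0 : 0 < h by near: h; exact: nbhs_right_gt.
have hd : h * C < d by rewrite -ltr_pdivlMr//; near: h; exact: nbhs_right_lt.
have norm_small s t : 0 <= s <= h -> 0 <= t <= h -> `|s *: ei + t *: ej| <= h * C.
  move=> /andP[s0 sh] /andP[t0 th]; rewrite (le_trans (ler_normD _ _))//.
  rewrite !normrZ !ger0_norm// (@le_trans _ _ (h * `|ei| + h * `|ej|))//.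
    by rewrite lerD// ler_wpM2r.
  by rewrite -mulrDr ler_wpM2l ?(ltW h0)// lerDl.
have Hst s t : 0 <= s <= h -> 0 <= t <= h ->
    differentiable f (s *: ei + (t *: ej + u)) /\
    `|partial i f (s *: ei + (t *: ej + u)) - partial i f u
      - 'd (partial i f) u (s *: ei + t *: ej)| <= e / 2 * h.
  move=> hs ht; have w_small := norm_small s t hs ht.
  have /Hd : ball 0 d (s *: ei + t *: ej).
    by rewrite -ball_normE /= sub0r normrN (le_lt_trans w_small).
  rewrite -addrA => -[dfw Hw]; split=> //.
  rewrite (le_trans Hw)// (le_trans (ler_wpM2l _ w_small))//.
    by rewrite divr_ge0 ?(ltW e0)// mulr_ge0// ltW.
  by rewrite le_eqVlt; apply/orP; left; apply/eqP; field; rewrite gt_eqF.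
pose phi (s : R) : R := f (s *: ei + (h *: ej + u)) - f (s *: ei + u).
have h0h : 0 <= h <= h by rewrite lexx ltW.
have h00 : 0 <= (0 : R) <= h by rewrite lexx ltW.
have dphi s : 0 <= s <= h -> is_derive s 1 phi
    (partial i f (s *: ei + (h *: ej + u)) - partial i f (s *: ei + u)).
  move=> hs; apply: is_deriveB; apply: is_derive_line.
    exact: (Hst s h hs h0h).1.
  by have := (Hst s 0 hs h00).1; rewrite scale0r add0r.
have [c ci phiE] : exists2 c, c \in `]0, h[%R & phi h - phi 0 =
    (partial i f (c *: ei + (h *: ej + u)) - partial i f (c *: ei + u)) * (h - 0).
  apply: (@MVT _ phi (fun s => partial i f (s *: ei + (h *: ej + u))
                                - partial i f (s *: ei + u))) => //.
    by move=> s; rewrite in_itv/= => /andP[s0 s1]; apply: dphi; rewrite !ltW.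
  apply: derivable_within_continuous => s.
  by rewrite in_itv/= => hs; have [] := dphi s hs.
have hc : 0 <= c <= h by move: ci; rewrite in_itv/= => /andP[c0 c1]; rewrite !ltW.
have [_ H1] := Hst c h hc h0h.
have [_ H2] := Hst c 0 hc h00.
rewrite scale0r add0r addr0 in H2.
have -> : second_difference f (h *: ei) (h *: ej) u = phi h - phi 0.
  by rewrite /second_difference /phi !scale0r !add0r; ring.
rewrite phiE subr0 (partialE _ dfi).
rewrite linearD !linearZ/= in H1; rewrite linearZ/= in H2.
set F1 := partial i f (c *: ei + (h *: ej + u)) in H1 *.
set F2 := partial i f (c *: ei + u) in H2 *.
rewrite -/ei -/ej in H1 H2 *.
set D1 := 'd _ u ei in H1 H2; set D2 := 'd _ u ej in H1 *.
(* The unknown intermediate value [c] drops out, because [c * D1] occurs in both linear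
   approximations. *)
have -> : (F1 - F2) * h - h * h * D2 =
   h * ((F1 - partial i f u - (c * D1 + h * D2)) - (F2 - partial i f u - c * D1)).
  by ring.
rewrite normrM (ger0_norm (ltW h0)) [e * h * h]mulrC ler_pM2l//.
rewrite (le_trans (ler_normB _ _))//.
by rewrite [e * h](_ : _ = e / 2 * h + e / 2 * h) ?lerD//; field.
Unshelve. all: by end_near. Qed.

(** The second difference is symmetric in its two directions and, divided by [h * h], is close to
    both mixed derivatives. *)
Lemma partial_comm (f : 'rV[R]_m -> R^o) i j u :
  (\forall v \near u, differentiable f v) ->
  differentiable (partial i f) u -> differentiable (partial j f) u ->
  partial j (partial i f) u = partial i (partial j f) u.
Proof.
move=> df dfi dfj; apply/eqP; rewrite -subr_eq0 -normr_le0.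
apply/ler_addgt0Pl => e e0; rewrite addr0.
have e2 : 0 < e / 2 by rewrite divr_gt0.
have [h [h0 [Hi Hj]]] := filter_ex (filterI (nbhs_right_gt (0 : R))
  (filterI (second_difference_approx j e2 df dfi)
           (second_difference_approx i e2 df dfj))).
rewrite -(ler_pM2r (mulr_gt0 h0 h0)).
have -> : `|partial j (partial i f) u - partial i (partial j f) u| * (h * h) =
  `|h * h * partial j (partial i f) u - h * h * partial i (partial j f) u|.
  by rewrite -mulrBr normrM [`|h * h|]ger0_norm 1?mulrC// ltW// mulr_gt0.
have sdC p q : second_difference f p q u = second_difference f q p u.
  by rewrite /second_difference addrCA [_ - f (p + u) - _]addrAC.
rewrite sdC in Hj.
rewrite (le_trans (ler_distD (second_difference f (h *: delta_mx 0 i) (h *: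
  delta_mx 0 j) u) _ _))//.
have -> : e * (h * h) = e / 2 * h * h + e / 2 * h * h by field.
by apply: lerD; [rewrite distrC; exact: Hi|exact: Hj].
Qed.

End SecondDerivatives.

(** * Linear algebra *)

Section Matrix2.
Context {F : fieldType}.
Implicit Types A C E : 'M[F]_2.

Lemma sum_ord2 (V : nmodType) (f : 'I_2 -> V) : \sum_(i < 2) f i = f 0 + f 1.
Proof.
by rewrite big_ord_recl big_ord1; congr (_ + f _); exact/val_inj.
Qed.

Lemma ord2P (P : 'I_2 -> Prop) : P 0 -> P 1 -> forall i, P i.
Proof.
move=> P0 P1 [[|[|//]] ilt].
  by rewrite (_ : Ordinal ilt = 0)//; exact: val_inj.
by rewrite (_ : Ordinal ilt = 1)//; exact: val_inj.
Qed.

Lemma det_mx2 A : \det A = A 0 0 * A 1 1 - A 0 1 * A 1 0.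
Proof.
rewrite (expand_det_row _ 0) sum_ord2 /cofactor !det_mx11 !mxE /= mul1r.
rewrite expr1 mulN1r mulrN.
have -> : lift 0 0 = 1 :> 'I_2 by exact: val_inj.
by have -> : lift 1 0 = 0 :> 'I_2 by exact: val_inj.
Qed.

Lemma invmx2 A : \det A != 0 ->
  [/\ invmx A 0 0 = A 1 1 / \det A, invmx A 0 1 = - A 0 1 / \det A,
      invmx A 1 0 = - A 1 0 / \det A & invmx A 1 1 = A 0 0 / \det A].
Proof.
move=> A0; have uA : A \in unitmx by rewrite unitmxE unitfE.
pose B := \matrix_(i < 2, j < 2)
  ((if i == 0 then (if j == 0 then A 1 1 else - A 0 1)
   else (if j == 0 then - A 1 0 else A 0 0)) / \det A).
have <- : B = invmx A.
  rewrite -[B](mulKmx uA) (_ : A *m B = 1%:M) ?mulmx1//.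
  apply/matrixP; apply: ord2P; apply: ord2P;
    rewrite !mxE sum_ord2 !mxE/= ?mulr1n ?mulr0n;
    by move: A0; rewrite det_mx2 => A0; field.
by split; rewrite !mxE.
Qed.

Lemma mxtrace_invmx2 A : \det A != 0 -> \tr (invmx A) = \tr A / \det A.
Proof.
move=> /invmx2[i00 _ _ i11].
by rewrite /mxtrace !sum_ord2 i00 i11 -mulrDl addrC.
Qed.

(** There is no need to invert [g]: as [h] sits in the lower right block, solving
    [T^T *m Y = block_mx 0 0 0 1%:M] gives [h = g *m - Y], so the trace is minus that of
    [invmx D^T]. In dimension 2 this equals [- \tr D / \det D], which replaces the inverse of [C] by
    [C]. *)
Lemma trace_block_metric (alpha : F) (B C E : 'M[F]_2) (J A : 'M[F]_2)
    (D := alpha *: (C *m invmx E)) (T := block_mx A 0 B D)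
    (g := T *m block_mx J 0 0 E *m T^T)
    (h := block_mx 0 0 0 (- alpha *: C) : 'M[F]_(2 + 2)) :
  E \in unitmx -> A \in unitmx -> J \in unitmx -> alpha != 0 ->
  (C \in unitmx -> g \in unitmx) /\
  (g \in unitmx -> \tr (invmx g *m h) = 0 <-> \tr (C *m invmx E) = 0).
Proof.
move=> uE uA uJ a0.
have uT : (T \in unitmx) = (C \in unitmx).
  rewrite unitmxE det_lblock unitrM -unitmxE uA/= -unitmxE.
  by rewrite unitmxZ ?unitfE// unitmx_mul unitmx_inv uE andbT.
have uQ : block_mx J 0 0 E \in unitmx.
  by rewrite unitmxE det_lblock unitrM -!unitmxE uJ.
have ug : (g \in unitmx) = (C \in unitmx).
  by rewrite !unitmx_mul unitmx_tr uQ uT andbT andbb.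
split=> [|gu]; first by rewrite ug.
have uC : C \in unitmx by rewrite -ug.
have uD : D \in unitmx by rewrite unitmxZ ?unitfE// unitmx_mul unitmx_inv uE andbT.
(* The last block column of the inverse of the block triangular matrix [T^T]. *)
pose Y : 'M[F]_(2 + 2) := block_mx 0 (- (invmx A^T *m B^T *m invmx D^T)) 0 (invmx D^T).
have TY : T^T *m Y = block_mx 0 0 0 1%:M.
  rewrite tr_block_mx mulmx_block trmx0 !mulmx0 !mul0mx !addr0 add0r.
  by rewrite mulmxN !mulmxA !mulmxV ?unitmx_tr// mul1mx addNr.
have gY : h = g *m - Y.
  rewrite mulmxN /g -!mulmxA TY mulmx_block !mulmx0 !mul0mx mulmx1 !addr0 add0r.
  rewrite mulmx_block !mulmx0 !mul0mx !addr0 ?add0r -scalemxAl mulmxKV//.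
  by rewrite opp_block_mx !oppr0 /h scaleNr.
rewrite gY mulKmx// linearN/= mxtrace_block mxtrace0 add0r.
rewrite -trmx_inv mxtrace_tr mxtrace_invmx2; last by rewrite -unitfE -unitmxE.
rewrite linearZ/=; split=> [/eqP|->]; last by rewrite mulr0 mul0r oppr0.
rewrite oppr_eq0 !mulf_eq0 invr_eq0 (negPf a0)/= => /orP[/eqP//|].
by rewrite -[_ == 0]negbK -unitfE -unitmxE uD.
Qed.

End Matrix2.

(** * The Euclidean product and frames along a surface in the 3-sphere *)

Section Dot.
Context {R : realType}.
Implicit Types (v w z : 'rV[R]_4) (a : R).

Lemma dotE v w : dot v w = \sum_(c < 4) v 0 c * w 0 c.
Proof. by rewrite /dot mxE; apply: eq_bigr => c _; rewrite mxE. Qed.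

Lemma dotC v w : dot v w = dot w v.
Proof. by rewrite !dotE; apply: eq_bigr => c _; rewrite mulrC. Qed.

Lemma dotDl v w z : dot (v + w) z = dot v z + dot w z.
Proof. by rewrite /dot mulmxDl mxE. Qed.

Lemma dotDr v w z : dot z (v + w) = dot z v + dot z w.
Proof. by rewrite dotC dotDl !(dotC z). Qed.

Lemma dotZl a v w : dot (a *: v) w = a * dot v w.
Proof. by rewrite /dot -scalemxAl mxE. Qed.

Lemma dotZr a v w : dot v (a *: w) = a * dot v w.
Proof. by rewrite dotC dotZl dotC. Qed.

Lemma dotNl v w : dot (- v) w = - dot v w.
Proof. by rewrite -scaleN1r dotZl mulN1r. Qed.

Lemma dotNr v w : dot v (- w) = - dot v w.
Proof. by rewrite dotC dotNl dotC. Qed.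

Lemma dot0l v : dot 0 v = 0.
Proof. by rewrite -(scale0r 0) dotZl mul0r. Qed.

Lemma dot0r v : dot v 0 = 0.
Proof. by rewrite dotC dot0l. Qed.

Definition dot_lin := (dotDl, dotDr, dotNl, dotNr, dotZl, dotZr, dot0l, dot0r).

Lemma dot_ge0 v : 0 <= dot v v.
Proof. by rewrite dotE; apply: sumr_ge0 => c _; rewrite -expr2 sqr_ge0. Qed.

Lemma dot_gt0 v : v != 0 -> 0 < dot v v.
Proof.
move=> v0; rewrite lt_neqAle dot_ge0 andbT eq_sym; apply: contra v0.
rewrite dotE psumr_eq0; last by move=> c _; rewrite -expr2 sqr_ge0.
move=> /allP vc; apply/eqP/rowP => c; rewrite mxE.
by have := vc c (mem_index_enum c); rewrite -expr2 sqrf_eq0 => /eqP.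
Qed.

(** Multiplied by [dot v v], the Gram determinant is the squared length of
    [- dot v w *: v + dot v v *: w], a combination with a nonzero second coefficient. *)
Lemma gram_det_gt0 v w : (forall a b : R, a *: v + b *: w = 0 -> a = 0 /\ b = 0) ->
  0 < dot v v * dot w w - dot v w ^+ 2.
Proof.
move=> vw0.
have v0 : v != 0.
  apply: contraPneq (oner_neq0 R) => v0; apply/negP; rewrite negbK; apply/eqP.
  by have [] := vw0 1 0; rewrite // v0 scaler0 scale0r addr0.
have vv0 := dot_gt0 v0.
rewrite -(pmulr_rgt0 _ vv0).
have -> : dot v v * (dot v v * dot w w - dot v w ^+ 2) =
   dot (- dot v w *: v + dot v v *: w) (- dot v w *: v + dot v v *: w).
  by rewrite !dot_lin (dotC w v); ring.
apply: dot_gt0; apply/eqP => /vw0[_] vv; by rewrite vv ltxx in vv0.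
Qed.

Lemma dot_bilinear : continuous_bilinear (@dot R : _ -> _ -> R^o).
Proof.
split; first by split=> [v|v] a w z /=; rewrite !dot_lin.
have -> : (fun p : 'rV[R]_4 * 'rV[R]_4 => dot p.1 p.2 : R^o) =
    (fun p => p.1 0 0 * p.2 0 0 + (p.1 0 (lift 0 0) * p.2 0 (lift 0 0)
      + (p.1 0 (lift 0 (lift 0 0)) * p.2 0 (lift 0 (lift 0 0))
      + (p.1 0 (lift 0 (lift 0 (lift 0 0))) * p.2 0 (lift 0 (lift 0 (lift 0 0)))
      + 0)))).
  by apply/funext => p; rewrite dotE !big_ord_recl big_ord0.
move=> p.
have cc (c : 'I_4) : (fun p : 'rV[R]_4 * 'rV[R]_4 => p.1 0 c * p.2 0 c : R) q
    @[q --> p] --> p.1 0 c * p.2 0 c.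
  apply: cvgM.
    apply: (@cvg_comp _ _ _ fst (fun v : 'rV[R]_4 => v 0 c) _ (nbhs p.1)).
      exact: cvg_fst.
    exact: coord_continuous.
  apply: (@cvg_comp _ _ _ snd (fun v : 'rV[R]_4 => v 0 c) _ (nbhs p.2)).
    exact: cvg_snd.
  exact: coord_continuous.
exact: cvgD (cc 0) (cvgD (cc (lift 0 0)) (cvgD (cc (lift 0 (lift 0 0)))
  (cvgD (cc (lift 0 (lift 0 (lift 0 0)))) (cvg_cst 0)))).
Qed.

Section Frame.
Context (X N : 'rV[R]_4) (T : 'I_2 -> 'rV[R]_4).
Hypotheses (XX : dot X X = 1) (NN : dot N N = 1) (NX : dot N X = 0).
Hypotheses (XT : forall k, dot X (T k) = 0) (NT : forall k, dot N (T k) = 0).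
Let g i j := dot (T i) (T j).
Let d := g 0 0 * g 1 1 - g 0 1 ^+ 2.
Hypothesis d0 : d != 0.

Let TE a b : dot (a *: T 0 + b *: T 1) (T 0) = a * g 0 0 + b * g 0 1.
Proof. by rewrite !dot_lin /g (dotC (T 1) (T 0)). Qed.

Let TE1 a b : dot (a *: T 0 + b *: T 1) (T 1) = a * g 0 1 + b * g 1 1.
Proof. by rewrite !dot_lin /g. Qed.

(** Pairing a vanishing combination of [X], [N], [T 0], [T 1] with each of these vectors kills its
    first two coefficients and leaves for the others a system of determinant [d]. The matrix with
    these four rows is thus invertible, and it annihilates [v^T]. *)
Lemma frame_eq0 v : dot v X = 0 -> dot v N = 0 -> (forall k, dot v (T k) = 0) ->
  v = 0.
Proof.
move=> vX vN vT.
pose F (i : 'I_4) : 'rV[R]_4 := nth 0 [:: X; N; T 0; T 1] i.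
pose A : 'M[R]_4 := \matrix_i F i.
have fA : row_free A.
  apply: inj_row_free => c.
  rewrite mulmx_sum_row !big_ord_recl big_ord0 !rowK /F /= addr0.
  set c0 := c 0 _; set c1 := c 0 _; set c2 := c 0 _; set c3 := c 0 _ => cA0.
  have cA w : dot (c0 *: X + (c1 *: N + (c2 *: T 0 + c3 *: T 1))) w = 0.
    by rewrite cA0 dot0l.
  have c00 : c0 = 0.
    by have := cA X; rewrite !dot_lin XX NX !(dotC _ X) !XT !mulr0 mulr1 !addr0.
  have c10 : c1 = 0.
    have := cA N.
    by rewrite !dot_lin NN (dotC X) NX !(dotC _ N) !NT !mulr0 mulr1 !addr0 add0r.
  have cT0 : c2 * g 0 0 + c3 * g 0 1 = 0.
    by have := cA (T 0); rewrite c00 c10 !scale0r !add0r TE.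
  have cT1 : c2 * g 0 1 + c3 * g 1 1 = 0.
    by have := cA (T 1); rewrite c00 c10 !scale0r !add0r TE1.
  have c20 : c2 = 0.
    apply/eqP; rewrite -(mulIr_eq0 _ (mulIf d0)); apply/eqP.
    transitivity (g 1 1 * (c2 * g 0 0 + c3 * g 0 1)
                  - g 0 1 * (c2 * g 0 1 + c3 * g 1 1)); first by rewrite /d; ring.
    by rewrite cT0 cT1 !mulr0 subrr.
  have c30 : c3 = 0.
    apply/eqP; rewrite -(mulIr_eq0 _ (mulIf d0)); apply/eqP.
    transitivity (g 0 0 * (c2 * g 0 1 + c3 * g 1 1)
                  - g 0 1 * (c2 * g 0 0 + c3 * g 0 1)); first by rewrite /d; ring.
    by rewrite cT0 cT1 !mulr0 subrr.
  apply/rowP => -[[|[|[|[|//]]]] lti]; rewrite mxE.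
  - by rewrite -c00; congr (c 0 _); exact: val_inj.
  - by rewrite -c10; congr (c 0 _); exact: val_inj.
  - by rewrite -c20; congr (c 0 _); exact: val_inj.
  - by rewrite -c30; congr (c 0 _); exact: val_inj.
have uA : A \in unitmx by rewrite -row_free_unit.
have Av : A *m v^T = 0.
  apply/matrixP => i j; rewrite ord1 [RHS]mxE.
  have -> : (A *m v^T) i 0 = dot (row i A) v.
    by rewrite /dot -row_mul !mxE; apply: eq_bigr => k _; rewrite !mxE.
  rewrite rowK dotC /F; case: i => -[|[|[|[|//]]]] lti //=.
by rewrite -[v]trmxK -[v^T](mulKmx uA) Av mulmx0 trmx0.
Qed.

(** Orthogonality to [X] and [N] makes [v] tangent, so [v] is recovered from its products with [T 0]
    and [T 1] by the inverse metric. The factor [d] clears the denominator of that inverse. *)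
Lemma tangent_dot v w : dot v X = 0 -> dot v N = 0 ->
  d * dot v w = g 1 1 * dot v (T 0) * dot w (T 0)
    - g 0 1 * (dot v (T 0) * dot w (T 1) + dot v (T 1) * dot w (T 0))
    + g 0 0 * dot v (T 1) * dot w (T 1).
Proof.
move=> vX vN.
pose a := g 1 1 * dot v (T 0) - g 0 1 * dot v (T 1).
pose b := g 0 0 * dot v (T 1) - g 0 1 * dot v (T 0).
have vE : d *: v = a *: T 0 + b *: T 1.
  apply/eqP; rewrite -subr_eq0; apply/eqP; apply: frame_eq0.
  - by rewrite !dot_lin vX !(dotC _ X) !XT; ring.
  - by rewrite !dot_lin vN !(dotC _ N) !NT; ring.
  - by apply: ord2P; rewrite dotDl dotNl ?TE ?TE1 dotZl /a /b /d; ring.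
by rewrite -dotZl vE !dot_lin /a /b !(dotC w); ring.
Qed.

End Frame.
End Dot.

(** * The Lorentz product of R^{1,4} *)

Section Lorentz.
Context {R : realType}.
Implicit Types (v w z : R14 (R := R)) (a : R).

Lemma lorentzC v w : lorentz v w = lorentz w v.
Proof. by rewrite /lorentz dotC mulrC. Qed.

Lemma lorentzDl v w z : lorentz (v + w) z = lorentz v z + lorentz w z.
Proof. by rewrite /lorentz /= dotDl mulrDl opprD addrACA. Qed.

Lemma lorentzDr v w z : lorentz z (v + w) = lorentz z v + lorentz z w.
Proof. by rewrite lorentzC lorentzDl !(lorentzC z). Qed.

Lemma lorentzZl a v w : lorentz (a *: v) w = a * lorentz v w.
Proof. by rewrite /lorentz /= dotZl mulrDr mulrN mulrA. Qed.

Lemma lorentzZr a v w : lorentz v (a *: w) = a * lorentz v w.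
Proof. by rewrite lorentzC lorentzZl lorentzC. Qed.

Lemma lorentzNl v w : lorentz (- v) w = - lorentz v w.
Proof. by rewrite -scaleN1r lorentzZl mulN1r. Qed.

Lemma lorentzNr v w : lorentz v (- w) = - lorentz v w.
Proof. by rewrite lorentzC lorentzNl lorentzC. Qed.

Lemma lorentz0l v : lorentz 0 v = 0.
Proof. by rewrite -(scale0r 0) lorentzZl mul0r. Qed.

Lemma lorentz0r v : lorentz v 0 = 0.
Proof. by rewrite lorentzC lorentz0l. Qed.

Definition lorentz_lin := (lorentzDl, lorentzDr, lorentzNl, lorentzNr,
  lorentzZl, lorentzZr, lorentz0l, lorentz0r).

Lemma lorentz_bilinear : continuous_bilinear (@lorentz R : _ -> _ -> R^o).
Proof.
split; first by split=> [v|v] a w z /=; rewrite !lorentz_lin.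
move=> p.
have c11 : (fun q : R14 (R := R) * R14 (R := R) => q.1.1 : R^o) q @[q --> p] --> p.1.1.
  by apply: (@cvg_comp _ _ _ fst fst _ (nbhs p.1)); exact: cvg_fst.
have c21 : (fun q : R14 (R := R) * R14 (R := R) => q.2.1 : R^o) q @[q --> p] --> p.2.1.
  by apply: (@cvg_comp _ _ _ snd fst _ (nbhs p.2)); [exact: cvg_snd|exact: cvg_fst].
have c12 : (fun q : R14 (R := R) * R14 (R := R) => q.1.2) q @[q --> p] --> p.1.2.
  by apply: (@cvg_comp _ _ _ fst snd _ (nbhs p.1)); [exact: cvg_fst|exact: cvg_snd].
have c22 : (fun q : R14 (R := R) * R14 (R := R) => q.2.2) q @[q --> p] --> p.2.2.
  by apply: (@cvg_comp _ _ _ snd snd _ (nbhs p.2)); exact: cvg_snd.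
have H := dot_bilinear.2 (p.1.2, p.2.2).
have cd : (fun q : R14 (R := R) * R14 (R := R) => dot q.1.2 q.2.2 : R^o) q @[q
  --> p] -->
    dot p.1.2 p.2.2.
  apply: (@cvg_comp _ _ _ (fun q : R14 (R := R) * R14 (R := R) => (q.1.2, q.2.2))
    (fun q => dot q.1 q.2 : R^o) _ (nbhs (p.1.2, p.2.2))); last exact: H.
  exact: (cvg_pair c12 c22).
exact: (cvgD (cvgN (cvgM c11 c21)) cd).
Qed.

End Lorentz.

Section Algebra.
Context {F : realFieldType}.

(* With [gij = X_i . X_j], [s] the square root of the determinant of [g],
   [Pij = Z_i . X_j], [zlkp = (d_k Z_l) . X_p] and [cijp = X_ij . X_p], the
   conclusion is the [X_0]-component of [d_k (s g^kl Z_l)]; the component along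
   [X_1] follows by exchanging the two coordinates. *)
Lemma codazzi_contraction (g00 g01 g11 s s0 s1 P00 P01 P11 h0 h1
    c000 c001 c010 c011 c110 c111 z000 z100 z010 z110 z001 z101 z011 : F)
  (w := fun p q c e => (g11 * p * c - g01 * (p * e + q * c) + g00 * q * e) / s ^+ 2) :
  g00 != 0 -> s != 0 -> s ^+ 2 = g00 * g11 - g01 ^+ 2 ->
  2 * s * s0 = (c000 + c000) * g11 + g00 * (c011 + c011) - 2 * g01 * (c001 + c010) ->
  2 * s * s1 = (c010 + c010) * g11 + g00 * (c111 + c111) - 2 * g01 * (c011 + c110) ->
  g11 * P00 - 2 * g01 * P01 + g00 * P11 = 0 ->
  (c011 + c011) * P00 + g11 * (z000 + w P00 P01 c000 c001)
    - 2 * ((c001 + c010) * P01 + g01 * (z001 + w P00 P01 c010 c011))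
    + ((c000 + c000) * P11 + g00 * (z101 + w P01 P11 c010 c011)) = 0 ->
  z010 - z100 = h1 * g00 - h0 * g01 ->
  z011 - z101 = h1 * g01 - h0 * g11 ->
  z001 + w P00 P01 c010 c011 = z100 + w P01 P11 c000 c001 ->
  z011 + w P00 P01 c110 c111 = z110 + w P01 P11 c010 c011 ->
  (((c011 + c011) - s0 * (g11 / s)) / s + (- (c011 + c110) - s1 * (- g01 / s))
    / s) * P00
  + ((- (c001 + c010) - s0 * (- g01 / s)) / s + ((c010 + c010) - s1 * (g00 /
    s)) / s) * P01
  + (g11 / s * z000 + - g01 / s * z100 + (- g01 / s * z010 + g00 / s * z110))
  = - s * h0.
Proof.
move=> g0 sn0 s2 s0E s1E trP dtrP z01 z11 sym0 sym1.
(* The nine relations are solved for [g11], [P11], [s0], [s1], [z001], [z101], [z010], [z011] and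
   [z110]. Substituting them so that no solved variable survives leaves a rational identity with
   denominators built from [g00] and [s]. *)
have g11E : g11 = (s ^+ 2 + g01 ^+ 2) / g00 by rewrite s2; field.
have P11E : P11 = (2 * g01 * P01 - g11 * P00) / g00.
  apply: (mulfI g0); rewrite mulrCA mulfV// mulr1.
  by apply/eqP; rewrite -subr_eq0 -trP; apply/eqP; ring.
have s2n0 : 2 * s != 0 by rewrite mulf_neq0// pnatr_eq0.
have s0E' : s0 = ((c000 + c000) * g11 + g00 * (c011 + c011) - 2 * g01 * (c001 +
  c010)) / (2 * s).
  by rewrite -s0E mulrAC mulfV// mul1r.
have s1E' : s1 = ((c010 + c010) * g11 + g00 * (c111 + c111) - 2 * g01 * (c011 +
  c110)) / (2 * s).
  by rewrite -s1E mulrAC mulfV// mul1r.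
have z001E : z001 = z100 + w P01 P11 c000 c001 - w P00 P01 c010 c011.
  by rewrite -sym0 addrK.
have z101E : z101 = - ((c011 + c011) * P00 + g11 * (z000 + w P00 P01 c000 c001)
    - 2 * ((c001 + c010) * P01 + g01 * (z001 + w P00 P01 c010 c011))
    + (c000 + c000) * P11 + g00 * w P01 P11 c010 c011) / g00.
  apply: (mulfI g0); rewrite mulrCA mulfV// mulr1.
  by apply/eqP; rewrite -subr_eq0 -dtrP; apply/eqP; ring.
have z010E : z010 = z100 + (h1 * g00 - h0 * g01) by rewrite -z01; ring.
have z011E : z011 = z101 + (h1 * g01 - h0 * g11) by rewrite -z11; ring.
have z110E : z110 = z011 + w P00 P01 c110 c111 - w P01 P11 c010 c011.
  by rewrite sym1 addrK.
rewrite z110E z011E z101E z010E z001E s0E' s1E' P11E /w g11E.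
clear -g0 sn0.
by field; rewrite g0 sn0.
Qed.

End Algebra.

Section LorentzFrame.
Context {R : realType} (nu y ys : R14 (R := R)) (xi : 'I_2 -> R14 (R := R)).
Hypotheses (yy : lorentz y y = 0) (ysys : lorentz ys ys = 0).
Hypotheses (ysy : lorentz ys y = -1).
Hypotheses (xiy : forall k, lorentz (xi k) y = 0).
Hypotheses (xiys : forall k, lorentz (xi k) ys = 0).
Hypotheses (ynu : lorentz y nu = 0) (ysnu : lorentz ys nu = 0).
Hypotheses (xinu : forall k, lorentz (xi k) nu = 0).
Hypothesis nondegenerate : forall v, lorentz v nu = 0 -> lorentz v y = 0 ->
  lorentz v ys = 0 -> (forall k, lorentz v (xi k) = 0) -> v = 0.
Let E : 'M[R]_2 := \matrix_(k, l) lorentz (xi k) (xi l).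
Hypothesis uE : E \in unitmx.

Let yys : lorentz y ys = -1. Proof. by rewrite lorentzC. Qed.

(** As [y] and [ys] are null with product -1, the coefficient of [v] along each of them is minus its
    product with the other. Subtracting these components and those along [xi] leaves a vector
    orthogonal to the whole frame, hence 0. *)
Lemma lorentz_frame v w : lorentz v nu = 0 -> lorentz v w =
  - lorentz v ys * lorentz w y - lorentz v y * lorentz w ys
  + \sum_(k < 2) \sum_(l < 2) lorentz v (xi k) * invmx E k l * lorentz w (xi l).
Proof.
move=> vnu; pose b l := \sum_(k < 2) lorentz v (xi k) * invmx E k l.
pose v' := v + lorentz v ys *: y + lorentz v y *: ys - b 0 *: xi 0 - b 1 *: xi 1.
have bE k : b 0 * lorentz (xi 0) (xi k) + b 1 * lorentz (xi 1) (xi k) = lorentz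
  v (xi k).
  transitivity (((\row_k lorentz v (xi k)) *m invmx E *m E) 0 k).
    by rewrite mxE sum_ord2 !mxE /b; congr (_ * _ + _ * _);
      apply: eq_bigr => i _; rewrite !mxE.
  by rewrite mulmxKV// mxE.
have v'0 : v' = 0.
  apply: nondegenerate.
  - by rewrite /v' !lorentz_lin vnu ynu ysnu !xinu; ring.
  - by rewrite /v' !lorentz_lin yy ysy !xiy; ring.
  - by rewrite /v' !lorentz_lin ysys yys !xiys; ring.
  - move=> k; rewrite /v' !lorentz_lin (lorentzC y) (lorentzC ys) xiy xiys -bE; ring.
have : lorentz v' w = 0 by rewrite v'0 lorentz0l.
rewrite /v' !lorentz_lin => H.
have -> : \sum_(k < 2) \sum_(l < 2) lorentz v (xi k) * invmx E k l * lorentz w (xi l)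
    = b 0 * lorentz (xi 0) w + b 1 * lorentz (xi 1) w.
  by rewrite /b !sum_ord2 !(lorentzC w) !mulrDl addrACA.
apply/eqP; rewrite -subr_eq0 -H; apply/eqP.
by rewrite !(lorentzC w); ring.
Qed.

(** [F] stands for the four tangent vectors of the 4-surface at a point, in the order alpha, rho,
    u^1, u^2, and [Xi] for the derivatives of its normal. The first two vectors lie in the plane of
    [y] and [ys], which is orthogonal to [xi], and the normal does not vary with alpha and rho; so
    only the lower right block of [h] survives. *)
Lemma trace_associate (alpha rho : R) (y' ys' : 'I_2 -> R14 (R := R))
    (F Xi : 'I_(2 + 2) -> R14 (R := R))
    (C := \matrix_(k, l) lorentz (y' k + rho *: ys' k) (xi l) : 'M[R]_2)
    (g := \matrix_(i, j) lorentz (F i) (F j))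
    (h := \matrix_(i, j) - lorentz (F i) (Xi j)) :
  0 < alpha ->
  F (lshift 2 0) = y + rho *: ys -> F (lshift 2 1) = alpha *: ys ->
  (forall k, F (rshift 2 k) = alpha *: (y' k + rho *: ys' k)) ->
  (forall k, Xi (lshift 2 k) = 0) -> (forall k, Xi (rshift 2 k) = xi k) ->
  (forall k, lorentz (y' k) nu = 0) -> (forall k, lorentz (ys' k) nu = 0) ->
  (C \in unitmx -> g \in unitmx) /\
  (g \in unitmx -> \tr (invmx g *m h) = 0 <-> \tr (C *m invmx E) = 0).
Proof.
move=> a0 F0 F1 F2 Xi1 Xi2 y'nu ys'nu.
(* [L] lists the coefficients along [y] and [ys], and [J] is the Gram matrix of that pair. [A] is
   the part of [L] coming from [y + rho *: ys] and [alpha *: ys]. [K] lists products with [xi], so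
   that the [xi] components contribute through [invmx E]. *)
pose L := \matrix_(i < 2 + 2, j < 2) - lorentz (F i) (if j == 0 then ys else y).
pose K := \matrix_(i < 2 + 2, j < 2) lorentz (F i) (xi j).
pose J : 'M[R]_2 := \matrix_(i, j) - (i != j)%:R.
pose A : 'M[R]_2 := \matrix_(i, j)
  (if i == 0 then if j == 0 then 1 else rho else if j == 0 then 0 else alpha).
have Fnu i : lorentz (F i) nu = 0.
  rewrite -[i]splitK; case: (fintype.split i) => k /=; last first.
    by rewrite F2 !lorentz_lin y'nu ys'nu mulr0 addr0 mulr0.
  move: k; apply: ord2P; first by rewrite F0 !lorentz_lin ynu ysnu mulr0 addr0.
  by rewrite F1 !lorentz_lin ysnu mulr0.
have gE : g = L *m J *m L^T + K *m invmx E *m K^T.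
  apply/matrixP => i j; rewrite mxE (lorentz_frame _ (Fnu i)) [RHS]mxE; congr (_ + _).
    rewrite !mxE sum_ord2 !mxE !sum_ord2 !mxE/=; ring.
  rewrite mxE exchange_big/=; apply: eq_bigr => l _.
  by rewrite !mxE big_distrl/=; apply: eq_bigr => k _; rewrite !mxE.
have LE : L = col_mx A (dsubmx L).
  rewrite -[LHS]vsubmxK; congr col_mx; apply/matrixP.
  apply: ord2P; apply: ord2P; rewrite !mxE/= ?F0 ?F1 !lorentz_lin ?yy ?ysys
    ?yys ?ysy; ring.
have KE : K = col_mx 0 (alpha *: C).
  rewrite -[LHS]vsubmxK; congr col_mx; apply/matrixP.
    apply: ord2P => l; rewrite !mxE ?F0 ?F1 !lorentz_lin !(lorentzC _ (xi l))
      xiys ?xiy; ring.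
  by move=> k l; rewrite !mxE F2 lorentzZl.
have hE : h = block_mx 0 0 0 (- alpha *: C).
  rewrite -[LHS]submxK; congr block_mx; apply/matrixP => k l; rewrite !mxE.
  - by rewrite Xi1 lorentz0r oppr0.
  - rewrite Xi2; move: k; apply: ord2P;
      by rewrite ?F0 ?F1 !lorentz_lin !(lorentzC _ (xi l)) xiys ?xiy; ring.
  - by rewrite Xi1 lorentz0r oppr0.
  - by rewrite Xi2 F2 lorentzZl mulNr.
have uA : A \in unitmx.
  by rewrite unitmxE det_mx2 !mxE/= unitfE mulr0 subr0 mul1r gt_eqF.
have uJ : J \in unitmx.
  by rewrite unitmxE det_mx2 !mxE/= unitfE; apply/eqP => /eqP;
    rewrite oppr0 mul0r sub0r mulrNN mulr1 oppr_eq0 oner_eq0.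
have Esym : E^T = E by apply/matrixP => k l; rewrite !mxE lorentzC.
set B := dsubmx L in LE.
have := trace_block_metric B C uE uA uJ (lt0r_neq0 a0).
set g' := _ *m _ *m _.
have -> : g' = g.
  rewrite gE LE KE /g' tr_block_mx !tr_col_mx trmx0 !mulmx_block !mul_col_mx
    !mul_mx_row.
  rewrite -!/(block_mx _ _ _ _) add_block_mx !(mul0mx, mulmx0, addr0, add0r).
  rewrite -!scalemxAl linearZ/= mulmxKV// trmx_mul trmx_inv Esym.
  by rewrite [(alpha *: C)^T]linearZ/= -!scalemxAr mulmxA.
by rewrite -hE.
Qed.

End LorentzFrame.

(** * Surfaces in a chart *)

(* Sealed, so that unification never unfolds the limits defining two
   derivatives when it compares them. *)
HB.lock Definition pd (R : realType) (m : nat) (V : normedModType R) (k : 'I_m)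
  (f : 'rV[R]_m -> V) : 'rV[R]_m -> V := partial k f.
Canonical pd_unlockable := Unlockable pd.unlock.

Lemma pdE (R : realType) (m : nat) (V : normedModType R) (k : 'I_m)
  (f : 'rV[R]_m -> V) : pd k f = partial k f.
Proof. by rewrite unlock. Qed.


Section SealedDerivative.
Context {R : realType} {m : nat}.
Implicit Types (u : 'rV[R]_m) (k : 'I_m).

Lemma differentiable_dot (f g : 'rV[R]_m -> 'rV[R]_4) u :
  differentiable f u -> differentiable g u ->
  differentiable (fun v => dot (f v) (g v) : R^o) u.
Proof. exact: (differentiable_bilinear dot_bilinear). Qed.

Lemma pd_dot (f g : 'rV[R]_m -> 'rV[R]_4) k u :
  differentiable f u -> differentiable g u ->
  pd k (fun v => dot (f v) (g v) : R^o) u =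
  dot (pd k f u) (g u) + dot (f u) (pd k g u).
Proof. by rewrite !pdE; exact: (partial_bilinear dot_bilinear). Qed.

Lemma pd_lorentz (f g : 'rV[R]_m -> R14 (R := R)) k u :
  differentiable f u -> differentiable g u ->
  pd k (fun v => lorentz (f v) (g v) : R^o) u =
  lorentz (pd k f u) (g u) + lorentz (f u) (pd k g u).
Proof. by rewrite !pdE; exact: (partial_bilinear lorentz_bilinear). Qed.

Lemma pd_add (V : normedModType R) (f g : 'rV[R]_m -> V) k u :
  differentiable f u -> differentiable g u ->
  pd k (fun v => f v + g v) u = pd k f u + pd k g u.
Proof. by rewrite !pdE; exact: partialD. Qed.

Lemma pd_mul (f g : 'rV[R]_m -> R^o) k u :
  differentiable f u -> differentiable g u ->
  pd k (fun v => f v * g v : R^o) u = pd k f u * g u + f u * pd k g u.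
Proof. by rewrite !pdE; exact: partial_mul. Qed.

Lemma pd_scale (V : normedModType R) (f : 'rV[R]_m -> R^o) (g : 'rV[R]_m -> V) k u :
  differentiable f u -> differentiable g u ->
  pd k (fun v => f v *: g v) u = pd k f u *: g u + f u *: pd k g u.
Proof. by rewrite !pdE; exact: partial_scale. Qed.

Lemma pd_pair (V W : normedModType R) (f : 'rV[R]_m -> V) (g : 'rV[R]_m -> W) k u :
  differentiable f u -> differentiable g u ->
  pd k (fun v => (f v, g v)) u = (pd k f u, pd k g u).
Proof. by rewrite !pdE; exact: partial_pair. Qed.

Context {U : set 'rV[R]_m}.
Hypothesis U_open : open U.

Lemma pd_on (V : normedModType R) (f g : 'rV[R]_m -> V) k u : U u ->
  (forall v, U v -> f v = g v) -> pd k f u = pd k g u.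
Proof.
move=> Uu fg; rewrite !pdE; apply: near_eq_partial.
by apply: filterS (nbhs_open U_open Uu) => v; exact: fg.
Qed.

Lemma pd_cst_on (V : normedModType R) (f : 'rV[R]_m -> V) a k u : U u ->
  (forall v, U v -> f v = a) -> pd k f u = 0.
Proof. by move=> Uu fa; rewrite (pd_on _ Uu fa) pdE partial_cst. Qed.

Lemma differentiable_on (V : normedModType R) (f g : 'rV[R]_m -> V) u : U u ->
  (forall v, U v -> f v = g v) -> differentiable f u -> differentiable g u.
Proof.
move=> Uu fg; apply: near_eq_differentiable.
by apply: filterS (nbhs_open U_open Uu) => v; exact: fg.
Qed.

Lemma smooth_dot (f g : 'rV[R]_m -> 'rV[R]_4) : smooth_on U f -> smooth_on U g ->
  smooth_on U (fun v => dot (f v) (g v) : R^o).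
Proof. exact: (smooth_bilinear U_open dot_bilinear). Qed.

Lemma smooth_pd (V : normedModType R) (f : 'rV[R]_m -> V) k :
  smooth_on U f -> smooth_on U (pd k f).
Proof. by rewrite pdE; exact: smooth_partial. Qed.

Lemma pd_coord n (f : 'rV[R]_m -> 'rV[R]_n) c k u : differentiable f u ->
  pd k (fun v => f v 0 c : R^o) u = pd k f u 0 c.
Proof. by rewrite !pdE; exact: partial_coord. Qed.

Lemma differentiable_coordf n (f : 'rV[R]_m -> 'rV[R]_n) c u :
  differentiable f u -> differentiable (fun v => f v 0 c : R^o) u.
Proof.
move=> df; exact: (@differentiable_comp _ _ _ _ f (fun w : 'rV[R]_n => w 0 c : R^o) u df
  (differentiable_coord _ _ _)).
Qed.

Lemma pd_comm n (f : 'rV[R]_m -> 'rV[R]_n) i j u : smooth_on U f -> U u ->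
  pd j (pd i f) u = pd i (pd j f) u.
Proof.
move=> sf Uu; apply/rowP => c.
have df (v : 'rV[R]_m) : U v -> differentiable f v := smooth_differentiable sf.
have dp k v : U v -> differentiable (pd k f) v.
  exact: smooth_differentiable (smooth_pd k sf).
have coordE k v : U v -> pd k f v 0 c = pd k (fun v => f v 0 c : R^o) v.
  by move=> Uv; rewrite pd_coord//; exact: df.
rewrite -(pd_coord c j (dp i u Uu)) -(pd_coord c i (dp j u Uu)).
rewrite (pd_on j Uu (coordE i)) (pd_on i Uu (coordE j)).
have dcoord k : differentiable (pd k (fun v => f v 0 c : R^o)) u.
  exact: (differentiable_on Uu (coordE k) (differentiable_coordf c (dp k u Uu))).
move: (dcoord i) (dcoord j); rewrite !pdE => di dj; apply: partial_comm => //.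
by apply: filterS (nbhs_open U_open Uu) => v /df; exact: differentiable_coordf.
Qed.

End SealedDerivative.

Section Chart.
Context {R : realType} (U : set 'rV[R]_2) (X N : 'rV[R]_2 -> 'rV[R]_4).
(** The mean curvature is a function known only through [hE] on [U], because [surf_H] is evaluated
    in the chart selected at each point and not in the chart under study. *)
Context (h : 'rV[R]_2 -> R^o).
Hypotheses (U_open : open U) (sX : smooth_on U X) (sN : smooth_on U N).
Hypothesis XX : forall u, U u -> dot (X u) (X u) = 1.
Hypothesis NN : forall u, U u -> dot (N u) (N u) = 1.
Hypothesis NX : forall u, U u -> dot (N u) (X u) = 0.
Hypothesis NT : forall u k, U u -> dot (N u) (pd k X u) = 0.
Let I := first_form (@dot R) X.
Let II := second_form (@dot R) X N.
Hypothesis det_gt0 : forall u, U u -> 0 < \det (I u).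
Hypothesis hE : forall u, U u -> h u = 2^-1 * \tr (invmx (I u) *m II u).
Hypothesis IIo0 : forall u, U u -> II u - h u *: I u != 0.

Let T k := pd k X.
Let g i j u : R^o := dot (T i u) (T j u).
Let d u : R^o := g 0 0 u * g 1 1 u - g 0 1 u * g 0 1 u.
Let Z k u := h u *: T k u + pd k N u.
Let P i j u : R^o := dot (Z i u) (T j u).

(** * First and second order relations of the surface *)

Let dX u : U u -> differentiable X u. Proof. exact: smooth_differentiable. Qed.
Let dN u : U u -> differentiable N u. Proof. exact: smooth_differentiable. Qed.
Let dT k u : U u -> differentiable (T k) u.
Proof. exact: smooth_differentiable (smooth_pd k sX). Qed.
Let dNk k u : U u -> differentiable (pd k N) u.
Proof. exact: smooth_differentiable (smooth_pd k sN). Qed.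

Let gC u : g 1 0 u = g 0 1 u. Proof. exact: dotC. Qed.

Let IE i j u : I u i j = g i j u. Proof. by rewrite mxE -!pdE. Qed.

Let IIE i j u : II u i j = - dot (T i u) (pd j N u).
Proof. by rewrite mxE -!pdE. Qed.

Let detE u : \det (I u) = d u.
Proof. by rewrite det_mx2 !IE gC. Qed.

Let d_gt0 u : U u -> 0 < d u. Proof. by move=> /det_gt0; rewrite detE. Qed.

Let invI u : U u ->
  [/\ invmx (I u) 0 0 = g 1 1 u / d u, invmx (I u) 0 1 = - g 0 1 u / d u,
      invmx (I u) 1 0 = - g 0 1 u / d u & invmx (I u) 1 1 = g 0 0 u / d u].
Proof.
by move=> /det_gt0/lt0r_neq0/invmx2[-> -> -> ->]; rewrite detE !IE gC.
Qed.

Let sg i j : smooth_on U (g i j).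
Proof. by apply: smooth_dot => //; exact: smooth_pd. Qed.

Let sd : smooth_on U d.
Proof.
by apply: smooth_add => //; [exact: smooth_mul|apply: smooth_opp => //;
  exact: smooth_mul].
Qed.

Let XT u k : U u -> dot (X u) (T k u) = 0.
Proof.
move=> Uu; have := pd_cst_on U_open k Uu XX.
rewrite pd_dot; [|exact: dX..].
by rewrite dotC -mulr2n => /eqP; rewrite mulrn_eq0/= => /eqP.
Qed.

Let NNk u k : U u -> dot (N u) (pd k N u) = 0.
Proof.
move=> Uu; have := pd_cst_on U_open k Uu NN.
rewrite pd_dot; [|exact: dN..].
by rewrite dotC -mulr2n => /eqP; rewrite mulrn_eq0/= => /eqP.
Qed.

Let XNk u k : U u -> dot (X u) (pd k N u) = 0.
Proof.
move=> Uu; have := pd_cst_on U_open k Uu NX.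
rewrite pd_dot; [|exact: dN|exact: dX].
by rewrite NT// addr0 dotC.
Qed.

Let Tsym i j u : U u -> pd j (T i) u = pd i (T j) u.
Proof. exact: pd_comm. Qed.

Let Nsym i j u : U u -> pd j (pd i N) u = pd i (pd j N) u.
Proof. exact: pd_comm. Qed.

Let TN i j u : U u -> dot (T i u) (pd j N u) = - dot (N u) (pd j (T i) u).
Proof.
move=> Uu; have := pd_cst_on U_open j Uu (fun v => NT i (u := v)).
rewrite pd_dot; [|exact: dN|exact: dT].
by move=> /eqP; rewrite addr_eq0 dotC => /eqP.
Qed.

Let IIsym u : U u -> dot (T 1 u) (pd 0 N u) = dot (T 0 u) (pd 1 N u).
Proof. by move=> Uu; rewrite !TN// Tsym. Qed.

Let ZX k u : U u -> dot (Z k u) (X u) = 0.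
Proof. by move=> Uu; rewrite dotDl dotZl dotC XT// dotC XNk// mulr0 addr0. Qed.

Let ZN k u : U u -> dot (Z k u) (N u) = 0.
Proof. by move=> Uu; rewrite dotDl dotZl dotC NT// dotC NNk// mulr0 addr0. Qed.

Let PE i j u : P i j u = h u * g i j u + dot (T j u) (pd i N u).
Proof. by rewrite /P /Z dotDl dotZl (dotC (pd i N u)). Qed.

Let Psym u : U u -> P 1 0 u = P 0 1 u.
Proof. by move=> Uu; rewrite !PE gC IIsym. Qed.

Let IIoE u : U u -> II u - h u *: I u = \matrix_(i, j) - P i j u.
Proof.
move=> Uu; have E i j : (II u - h u *: I u) i j = - P j i u.
  rewrite [LHS]mxE [X in _ + X]mxE [X in _ - X]mxE IE IIE PE opprD addrC.
  by rewrite /g dotC.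
by apply/matrixP; apply: ord2P; apply: ord2P; rewrite E [RHS]mxE ?Psym.
Qed.

(** With the inverse metric cleared, the definition of [h] yields both the trace-freeness of [P] and
    the smoothness of [h]. *)
Let hE' u : U u -> h u * d u = - 2^-1 * (g 1 1 u * dot (T 0 u) (pd 0 N u)
  - 2 * g 0 1 u * dot (T 0 u) (pd 1 N u) + g 0 0 u * dot (T 1 u) (pd 1 N u)).
Proof.
move=> Uu; have dn0 := lt0r_neq0 (d_gt0 Uu).
rewrite hE// /mxtrace !sum_ord2 ![(invmx _ *m _) _ _]mxE !sum_ord2 !IIE.
have [-> -> -> ->] := invI Uu; rewrite (IIsym Uu).
by field.
Qed.

Let trP u : U u -> g 1 1 u * P 0 0 u - 2 * g 0 1 u * P 0 1 u + g 0 0 u * P 1 1 u = 0.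
Proof.
move=> Uu; have := hE' Uu; rewrite !PE (IIsym Uu).
set n00 := dot _ _; set n01 := dot _ _; set n11 := dot _ _ => hd.
transitivity (2 * (h u * d u) + (g 1 1 u * n00 - 2 * g 0 1 u * n01 + g 0 0 u * n11)).
  by rewrite /d; ring.
by rewrite hd; field.
Qed.

Let sh : smooth_on U h.
Proof.
have sn i j : smooth_on U (fun u => dot (T i u) (pd j N u) : R^o).
  by apply: smooth_dot => //; exact: smooth_pd.
apply: (@smooth_ext _ _ _ U_open _ (fun u => - 2^-1 * (g 1 1 u * dot (T 0 u) (pd 0 N u)
  - 2 * g 0 1 u * dot (T 0 u) (pd 1 N u) + g 0 0 u * dot (T 1 u) (pd 1 N u)) *
      (d u)^-1)).
  by move=> u Uu; rewrite -hE'// mulfK//; exact: lt0r_neq0 (d_gt0 Uu).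
apply: smooth_mul => //; last first.
  by apply: smooth_inv => // u Uu; exact: lt0r_neq0 (d_gt0 Uu).
apply: smooth_mul => //; first exact: smooth_cst.
apply: smooth_add => //; last exact: smooth_mul.
apply: smooth_add => //; first exact: smooth_mul.
apply: smooth_opp => //; apply: smooth_mul => //; apply: smooth_mul => //.
exact: smooth_cst.
Qed.

Let sZ k : smooth_on U (Z k).
Proof.
apply: smooth_add => //; last exact: smooth_pd.
by apply: (smooth_bilinear U_open (scale_bilinear _)) => //; exact: smooth_pd.
Qed.

Let dh u : U u -> differentiable h u.
Proof. exact: (smooth_differentiable sh). Qed.
Let dhk k u : U u -> differentiable (pd k h) u.
Proof. exact: (smooth_differentiable (smooth_pd k sh)). Qed.
Let dZ k u : U u -> differentiable (Z k) u.
Proof. exact: (smooth_differentiable (sZ k)). Qed.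
Let dg i j u : U u -> differentiable (g i j) u.
Proof. exact: (smooth_differentiable (sg i j)). Qed.

(** Christoffel symbols of the first kind. The numbers [z l k p] are the tangential products of the
    plain, not covariant, derivatives of [Z l]. *)
Let c i j p u := dot (pd j (T i) u) (T p u).
Let z l k p u := dot (pd k (Z l) u) (T p u).

Let cC i j p u : U u -> c i j p u = c j i p u.
Proof. by move=> Uu; rewrite /c Tsym. Qed.

Let pd_g i j k u : U u -> pd k (g i j) u = c i k j u + c j k i u.
Proof. by move=> Uu; rewrite pd_dot; [rewrite (dotC (T i u))|exact: dT..]. Qed.

Let pd_P l p k u : U u -> pd k (P l p) u = z l k p u + dot (Z l u) (pd k (T p) u).
Proof. by move=> Uu; rewrite pd_dot; [|exact: dZ|exact: dT]. Qed.

Let Z_dot k u w : U u -> d u * dot (Z k u) w =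
  g 1 1 u * P k 0 u * dot w (T 0 u)
  - g 0 1 u * (P k 0 u * dot w (T 1 u) + P k 1 u * dot w (T 0 u))
  + g 0 0 u * P k 1 u * dot w (T 1 u).
Proof.
move=> Uu; rewrite /d -expr2.
apply: (tangent_dot (T := fun k => T k u) (XX Uu) (NN Uu) (NX Uu)) => //.
- by move=> j; exact: XT.
- by move=> j; exact: NT.
- by apply: lt0r_neq0; rewrite expr2; exact: d_gt0.
- exact: ZX.
- exact: ZN.
Qed.

Let zX l k u : U u -> dot (pd k (Z l) u) (X u) = - P l k u.
Proof.
move=> Uu; have := pd_cst_on U_open k Uu (fun v => ZX l (u := v)).
rewrite pd_dot; [|exact: dZ|exact: dX].
by move=> /eqP; rewrite addr_eq0 => /eqP.
Qed.

Let zN l k u : U u ->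
  dot (pd k (Z l) u) (N u) = - dot (Z l u) (Z k u) + h u * P l k u.
Proof.
move=> Uu; have := pd_cst_on U_open k Uu (fun v => ZN l (u := v)).
rewrite pd_dot; [|exact: dZ|exact: dN].
move=> /eqP; rewrite addr_eq0 => /eqP ->.
have -> : pd k N u = Z k u - h u *: T k u by rewrite addrC addKr.
by rewrite dotDr dotNr dotZr opprD opprK.
Qed.

Let pd_Z l k u : U u ->
  pd k (Z l) u = pd k h u *: T l u + h u *: pd k (T l) u + pd k (pd l N) u.
Proof.
move=> Uu; rewrite /Z pdE partialD; last 2 first.
- by apply: differentiable_scale; [exact: dh|exact: dT].
- exact: dNk.
by rewrite partial_scale ?pdE//; [exact: dh|exact: dT].
Qed.

(** The Codazzi equation: in [d_1 Z_0 - d_0 Z_1] the second derivatives of [X] and [N] cancel, and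
    only derivatives of [h] remain. *)
Let Z_anti p u : U u -> z 0 1 p u - z 1 0 p u = pd 1 h u * g 0 p u - pd 0 h u * g 1 p u.
Proof.
move=> Uu; rewrite /z !pd_Z// (Nsym 0 1 Uu) (Tsym 0 1 Uu) !dot_lin /g.
by ring.
Qed.

(** * The Laplacian in divergence form and the contracted Codazzi equations *)

Let s u : R^o := Num.sqrt (d u).
(** The coefficients of the divergence form: [s] times the Laplacian of [f] is the sum of the
    [d_i (G i j * d_j f)]. *)
Let G i j u : R^o := Num.sqrt (\det (I u)) * invmx (I u) i j.

Let s_gt0 u : U u -> 0 < s u. Proof. by move=> Uu; rewrite sqrtr_gt0 d_gt0. Qed.
Let s_neq0 u : U u -> s u != 0. Proof. by move=> /s_gt0; exact: lt0r_neq0. Qed.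
Let s2 u : U u -> s u * s u = d u.
Proof. by move=> Uu; rewrite -expr2 sqr_sqrtr// ltW// d_gt0. Qed.

Let dd u : U u -> differentiable d u.
Proof. exact: (smooth_differentiable sd). Qed.

Let ds u : U u -> differentiable s u.
Proof.
move=> Uu; apply: (@differentiable_comp _ _ _ _ d (Num.sqrt : R -> R)); first exact: dd.
by apply/derivable1_diffP; have [] := is_derive1_sqrt (d_gt0 Uu).
Qed.

Let GE u : U u -> [/\ G 0 0 u = g 1 1 u * (s u)^-1, G 0 1 u = - g 0 1 u * (s u)^-1,
  G 1 0 u = - g 0 1 u * (s u)^-1 & G 1 1 u = g 0 0 u * (s u)^-1].
Proof.
move=> Uu; have := s_neq0 Uu; rewrite /G detE -/(s u).
by have [-> -> -> ->] := invI Uu; rewrite -s2// => sn0; split; field.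
Qed.

Let pd_s k u : U u -> 2 * s u * pd k s u =
  pd k (g 0 0) u * g 1 1 u + g 0 0 u * pd k (g 1 1) u - 2 * g 0 1 u * pd k (g 0 1) u.
Proof.
move=> Uu.
(* Differentiating [s * s = d] gives the derivative of [s] without differentiating the square
   root. *)
have pdd : pd k d u = pd k s u * s u + s u * pd k s u.
  by rewrite -(pd_on U_open k Uu s2) !pdE partial_mul//; exact: ds.
rewrite mulrAC -[LHS]addr0 -(subrr (pd k s u * s u)).
have -> : 2 * pd k s u * s u + (pd k s u * s u - pd k s u * s u) = pd k d u.
  by rewrite pdd; ring.
rewrite /d !pdE partialD; last 2 first.
- by apply: differentiable_mul; exact: dg.
- by apply: differentiableN; apply: differentiable_mul; exact: dg.
rewrite partialN; last by apply: differentiable_mul; exact: dg.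
rewrite !partial_mul; [|exact: dg..].
by ring.
Qed.

Let pd_div_s (f : 'rV[R]_2 -> R^o) k u : U u -> differentiable f u ->
  pd k (fun v => f v * (s v)^-1 : R^o) u =
  (pd k f u - pd k s u * (f u / s u)) / s u.
Proof.
move=> Uu df; have sn0 := s_neq0 Uu; have dsu := ds Uu.
rewrite !pdE partial_mul//; last exact: differentiableV.
by rewrite partial_inv//; field.
Qed.

Let pd_G k u : U u ->
  [/\ pd k (G 0 0) u = (pd k (g 1 1) u - pd k s u * (g 1 1 u / s u)) / s u,
  pd k (G 0 1) u = (- pd k (g 0 1) u - pd k s u * (- g 0 1 u / s u)) / s u,
  pd k (G 1 0) u = (- pd k (g 0 1) u - pd k s u * (- g 0 1 u / s u)) / s u &
  pd k (G 1 1) u = (pd k (g 0 0) u - pd k s u * (g 0 0 u / s u)) / s u].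
Proof.
move=> Uu.
have pdN : pd k (fun v => - g 0 1 v : R^o) u = - pd k (g 0 1) u.
  by rewrite !pdE partialN//; exact: dg.
have dN01 : differentiable (fun v => - g 0 1 v : R^o) u by apply:
  differentiableN; exact: dg.
split.
- rewrite -pd_div_s//; last exact: dg.
  by apply: (pd_on U_open) => // v /GE[].
- by rewrite -pdN -pd_div_s//; apply: (pd_on U_open) => // v /GE[].
- by rewrite -pdN -pd_div_s//; apply: (pd_on U_open) => // v /GE[].
- rewrite -pd_div_s//; last exact: dg.
  by apply: (pd_on U_open) => // v /GE[].
Qed.

Let dP i j u : U u -> differentiable (P i j) u.
Proof. by move=> Uu; apply: differentiable_dot; [exact: dZ|exact: dT]. Qed.

Let pd_trP k u : U u ->
  pd k (g 1 1) u * P 0 0 u + g 1 1 u * pd k (P 0 0) u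
  - 2 * (pd k (g 0 1) u * P 0 1 u + g 0 1 u * pd k (P 0 1) u)
  + (pd k (g 0 0) u * P 1 1 u + g 0 0 u * pd k (P 1 1) u) = 0.
Proof.
move=> Uu; have := pd_cst_on U_open k Uu trP; rewrite !pdE.
have [dg00 dg01 dg11] := And3 (dg 0 0 Uu) (dg 0 1 Uu) (dg 1 1 Uu).
have [dP00 dP01 dP11] := And3 (dP 0 0 Uu) (dP 0 1 Uu) (dP 1 1 Uu).
have [d1 d2 d3] := And3 (differentiable_mul dg11 dP00)
  (differentiable_mul (differentiable_mul (differentiable_cst (2 : R^o) u) dg01) dP01)
  (differentiable_mul dg00 dP11).
rewrite partialD//; last exact: differentiableB.
rewrite partialD//; last exact: differentiableN.
rewrite partialN// !partial_mul//; last first.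
  by apply: differentiable_mul => //; exact: differentiable_cst.
by rewrite partial_cst => <-; ring.
Qed.

(** [Z l] is tangent, so it sees only the tangential part of the second derivatives of [X], that is,
    the Christoffel symbols. This is the expression [w] of [codazzi_contraction]. *)
Let w_eq l k p u : U u -> dot (Z l u) (pd k (T p) u) =
  (g 1 1 u * P l 0 u * c p k 0 u - g 0 1 u * (P l 0 u * c p k 1 u + P l 1 u * c p k 0 u)
   + g 0 0 u * P l 1 u * c p k 1 u) / s u ^+ 2.
Proof.
move=> Uu; have dn0 := lt0r_neq0 (d_gt0 Uu).
by rewrite expr2 s2// -Z_dot// mulrC mulKf.
Qed.

Let pd_Psym k u : U u -> pd k (P 1 0) u = pd k (P 0 1) u.
Proof. by move=> Uu; apply: (pd_on U_open) => // v; exact: Psym. Qed.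

(** As [P = - IIo], this is the component along [T 0] of the classical relation div IIo = dH,
    multiplied by the area density [s]. *)
Let codazzi0 u : U u ->
  (pd 0 (G 0 0) u + pd 1 (G 1 0) u) * P 0 0 u
  + (pd 0 (G 0 1) u + pd 1 (G 1 1) u) * P 0 1 u
  + (G 0 0 u * z 0 0 0 u + G 0 1 u * z 1 0 0 u
     + (G 1 0 u * z 0 1 0 u + G 1 1 u * z 1 1 0 u)) = - s u * pd 0 h u.
Proof.
move=> Uu.
have [-> -> -> ->] := GE Uu.
have [-> -> _ _] := pd_G 0 Uu; have [_ _ -> ->] := pd_G 1 Uu.
have g00n0 : g 0 0 u != 0.
  apply: contraTneq (d_gt0 Uu) => g0; rewrite /d g0 mul0r sub0r.
  by rewrite -leNgt oppr_le0 -expr2 sqr_ge0.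
have s2E : s u ^+ 2 = g 0 0 u * g 1 1 u - g 0 1 u ^+ 2 by rewrite !expr2 s2.
have := pd_trP 0 Uu.
have := pd_s 0 Uu; have := pd_s 1 Uu.
have := pd_Psym 0 Uu; have := pd_Psym 1 Uu.
rewrite !pd_P// !pd_g// !w_eq// Psym// (cC 1 0 0 Uu) (cC 1 0 1 Uu) => sym1 sym0
  s1E s0E dtr.
have := codazzi_contraction g00n0 (s_neq0 Uu) s2E s0E s1E (trP Uu) dtr
  (etrans (Z_anti 0 Uu) _) (Z_anti 1 Uu) (esym sym0) (esym sym1).
by rewrite gC; apply.
Qed.

Let codazzi1 u : U u ->
  (pd 0 (G 0 0) u + pd 1 (G 1 0) u) * P 0 1 u
  + (pd 0 (G 0 1) u + pd 1 (G 1 1) u) * P 1 1 u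
  + (G 0 0 u * z 0 0 1 u + G 0 1 u * z 1 0 1 u
     + (G 1 0 u * z 0 1 1 u + G 1 1 u * z 1 1 1 u)) = - s u * pd 1 h u.
Proof.
move=> Uu.
have [-> -> -> ->] := GE Uu.
have [-> -> _ _] := pd_G 0 Uu; have [_ _ -> ->] := pd_G 1 Uu.
have g11n0 : g 1 1 u != 0.
  apply: contraTneq (d_gt0 Uu) => g0; rewrite /d g0 mulr0 sub0r.
  by rewrite -leNgt oppr_le0 -expr2 sqr_ge0.
have s2E : s u ^+ 2 = g 1 1 u * g 0 0 u - g 0 1 u ^+ 2.
  by rewrite !expr2 s2// mulrC.
have := pd_trP 1 Uu; rewrite -(pd_Psym 1 Uu); have := pd_s 0 Uu; have := pd_s 1 Uu.
have := pd_Psym 0 Uu; have := pd_Psym 1 Uu.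
rewrite !pd_P// !pd_g// !w_eq// Psym// (cC 1 0 0 Uu) (cC 1 0 1 Uu).
move=> sym1 sym0 s1E s0E dtr.
have A0 := Z_anti 0 Uu; have A1 := Z_anti 1 Uu; rewrite gC in A0.
have trPu := trP Uu.
have eq_by (a b a' b' : R) : a = b -> a' - b' = a - b -> a' = b'.
  by move=> -> /eqP; rewrite subrr subr_eq0 => /eqP.
have eq_byN (a b a' b' : R) : a = b -> a' - b' = b - a -> a' = b'.
  by move=> -> /eqP; rewrite subrr subr_eq0 => /eqP.
(* The same identity with the two coordinates exchanged. Its hypotheses then agree with the
   available equations only up to rearrangement, and up to sign for the antisymmetric ones, which
   [eq_by] and [eq_byN] absorb. *)
have := @codazzi_contraction R (g 1 1 u) (g 0 1 u) (g 0 0 u) (s u) (pd 1 s u) (pd 0 s u)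
  (P 1 1 u) (P 0 1 u) (P 0 0 u) (pd 1 h u) (pd 0 h u) (c 1 1 1 u) (c 1 1 0 u)
  (c 0 1 1 u) (c 0 1 0 u) (c 0 0 1 u) (c 0 0 0 u) (z 1 1 1 u) (z 0 1 1 u)
  (z 1 0 1 u) (z 0 0 1 u) (z 1 1 0 u) (z 0 1 0 u) (z 1 0 0 u) g11n0 (s_neq0 Uu) s2E.
move=> H; refine (eq_trans _ (H _ _ _ _ _ _ _ _)); first by ring.
- by apply: (eq_by _ _ _ _ s1E); ring.
- by apply: (eq_by _ _ _ _ s0E); ring.
- by apply: (eq_by _ _ _ _ trPu); ring.
- by apply: (eq_by _ _ _ _ dtr); ring.
- by apply: (eq_byN _ _ _ _ A1); ring.
- by apply: (eq_byN _ _ _ _ A0); ring.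
- by apply: (eq_by _ _ _ _ sym1); ring.
- by apply: (eq_by _ _ _ _ sym0); ring.
Qed.

(* The determinant of [P = - IIo]; nonzero because [P] is trace-free and
   nonzero, and [I] is definite. *)
Let D u : R^o := P 0 0 u * P 1 1 u - P 0 1 u * P 0 1 u.

Let sP i j : smooth_on U (P i j).
Proof. by apply: smooth_dot => //; exact: smooth_pd. Qed.

Let sD : smooth_on U D.
Proof.
by apply: smooth_add => //; [exact: smooth_mul|apply: smooth_opp => //;
  exact: smooth_mul].
Qed.

Let g00_neq0 u : U u -> g 0 0 u != 0.
Proof.
move=> Uu; apply: contraTneq (d_gt0 Uu) => g0; rewrite /d g0 mul0r sub0r.
by rewrite -leNgt oppr_le0 -expr2 sqr_ge0.
Qed.

Let D_neq0 u : U u -> D u != 0.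
Proof.
move=> Uu; apply/eqP => D0; have g0 := g00_neq0 Uu; have tr := trP Uu.
(* Modulo the trace relation the left-hand side is [- g 0 0 u ^+ 2 * D u]. If [D u] vanished, both
   nonnegative terms would vanish, forcing [P = 0] against [IIo0]. *)
have sum0 : (g 0 0 u * P 0 1 u - g 0 1 u * P 0 0 u) ^+ 2 + d u * P 0 0 u ^+ 2 = 0.
  transitivity (- g 0 0 u * (g 0 0 u * D u)
    + g 0 0 u * P 0 0 u * (g 1 1 u * P 0 0 u - 2 * g 0 1 u * P 0 1 u + g 0 0 u
      * P 1 1 u)).
    by rewrite /D /d; ring.
  by rewrite D0 tr !mulr0 addr0.
have /andP[/eqP q0 /eqP r0] :
    ((g 0 0 u * P 0 1 u - g 0 1 u * P 0 0 u) ^+ 2 == 0) && (d u * P 0 0 u ^+ 2 == 0).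
  by rewrite -paddr_eq0 ?sum0// ?sqr_ge0// mulr_ge0 ?sqr_ge0// ltW// d_gt0.
have P00 : P 0 0 u = 0.
  by move/eqP: r0; rewrite mulf_eq0 (negPf (lt0r_neq0 (d_gt0 Uu)))/= sqrf_eq0 => /eqP.
have P01 : P 0 1 u = 0.
  move/eqP: q0; rewrite sqrf_eq0 P00 mulr0 subr0 mulf_eq0 (negPf g0)/=.
  by move=> /eqP.
have P11 : P 1 1 u = 0.
  move: tr; rewrite P00 P01 !mulr0 subr0 add0r => /eqP.
  by rewrite mulf_eq0 (negPf g0)/= => /eqP.
have /eqP[] := IIo0 Uu; rewrite IIoE//.
by apply/matrixP; apply: ord2P; apply: ord2P; rewrite !mxE ?Psym// ?P00 ?P01 ?P11 oppr0.
Qed.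

(* The solution of [P a = dh], i.e. the tangential part of y^*: orthogonality of
   y^* to [xi_k] reads [P_kl a^l = h_k]. *)
Let a0 u : R^o := (P 1 1 u * pd 0 h u - P 0 1 u * pd 1 h u) * (D u)^-1.
Let a1 u : R^o := (P 0 0 u * pd 1 h u - P 0 1 u * pd 0 h u) * (D u)^-1.

Let aE0 u : U u -> P 0 0 u * a0 u + P 0 1 u * a1 u = pd 0 h u.
Proof. by move=> /D_neq0; rewrite /a0 /a1 /D => D0; field. Qed.

Let aE1 u : U u -> P 0 1 u * a0 u + P 1 1 u * a1 u = pd 1 h u.
Proof. by move=> /D_neq0; rewrite /a0 /a1 /D => D0; field. Qed.

Let shk k : smooth_on U (pd k h). Proof. exact: smooth_pd. Qed.

Let sa0 : smooth_on U a0.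
Proof.
apply: smooth_mul => //; last by apply: smooth_inv => // u; exact: D_neq0.
apply: smooth_add => //; first exact: smooth_mul.
by apply: smooth_opp => //; exact: smooth_mul.
Qed.

Let sa1 : smooth_on U a1.
Proof.
apply: smooth_mul => //; last by apply: smooth_inv => // u; exact: D_neq0.
apply: smooth_add => //; first exact: smooth_mul.
by apply: smooth_opp => //; exact: smooth_mul.
Qed.

(** * The light cone lift, the conformal Gauss map and an explicit dual lift *)

Let q u : R^o := 2^-1 * (g 0 0 u * (a0 u * a0 u) + 2 * (g 0 1 u * (a0 u * a1 u))
  + g 1 1 u * (a1 u * a1 u) + h u * h u).

Let y u : R14 (R := R) := (1, X u).
Let xi u : R14 (R := R) := h u *: y u + ((0, N u) : R14).
(** Write y* as [(t, b X + a^k T_k + c N)]. Product -1 with [y] means [t - b = 1]; orthogonality to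
    [xi] then gives [c = h]; nullity gives [t + b = |a|^2 + h^2 = 2 q]. Hence [t = 1/2 + q] and
    [b = q - 1/2]. *)
Let ysX u := (q u - 2^-1) *: X u + a0 u *: T 0 u + a1 u *: T 1 u + h u *: N u.
Let ys u : R14 (R := R) := (2^-1 + q u, ysX u).

Let sq : smooth_on U q.
Proof.
apply: smooth_mul => //; first exact: smooth_cst.
by do ![apply: smooth_add => //|apply: smooth_mul => //|exact: smooth_cst].
Qed.

Let sT k : smooth_on U (T k). Proof. exact: smooth_pd. Qed.

Let sysX : smooth_on U ysX.
Proof.
have sZ' (f : 'rV[R]_2 -> R^o) (v : 'rV[R]_2 -> 'rV[R]_4) : smooth_on U f ->
    smooth_on U v -> smooth_on U (fun u => f u *: v u).
  exact: (smooth_bilinear U_open (scale_bilinear _)).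
do !apply: smooth_add => //; apply: sZ' => //.
by apply: smooth_add => //; exact: smooth_cst.
Qed.

Let dys u : U u -> differentiable ys u.
Proof.
move=> Uu; apply: differentiable_pair; last exact: (smooth_differentiable sysX).
apply: differentiableD; first exact: differentiable_cst.
exact: (smooth_differentiable sq).
Qed.

Let dy u : U u -> differentiable y u.
Proof. by move=> Uu; apply: differentiable_pair; [exact:
  differentiable_cst|exact: dX]. Qed.

Let pd_y k u : U u -> pd k y u = (0, T k u).
Proof.
move=> Uu; rewrite pdE partial_pair ?partial_cst -?pdE//; exact: dX.
Qed.

Let pd_xi k u : U u -> pd k xi u = (pd k h u, pd k h u *: X u + Z k u).
Proof.
move=> Uu; rewrite /xi pdE partialD; last 2 first.
- by apply: differentiable_scale; [exact: dh|exact: dy].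
- by apply: differentiable_pair; [exact: differentiable_cst|exact: dN].
rewrite partial_scale; [|exact: dh|exact: dy].
rewrite -(pdE k y) pd_y//.
rewrite partial_pair; [|exact: differentiable_cst|exact: dN].
rewrite partial_cst -!pdE.
congr (_, _); first by rewrite /= scaler0 !addr0; exact: mulr1.
by rewrite /= addrA.
Qed.

Let dot_ysX u w : dot (ysX u) w =
  (q u - 2^-1) * dot (X u) w + a0 u * dot (T 0 u) w + a1 u * dot (T 1 u) w + h
    u * dot (N u) w.
Proof. by rewrite /ysX !dotDl !dotZl. Qed.

Let lorentzE a v b w : lorentz ((a, v) : R14 (R := R)) (b, w) = - (a * b) + dot v w.
Proof. by []. Qed.

Let yy u : U u -> lorentz (y u) (y u) = 0.
Proof. by move=> Uu; rewrite lorentzE XX// mulr1 addNr. Qed.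

Let ysy u : U u -> lorentz (ys u) (y u) = -1.
Proof.
move=> Uu; rewrite lorentzE dot_ysX XX// !(dotC (T _ u)) !XT// NX//.
by field.
Qed.

Let xiE u : xi u = (h u, h u *: X u + N u).
Proof. by congr (_, _); rewrite /= addr0; exact: mulr1. Qed.

Let ysxi u : U u -> lorentz (ys u) (xi u) = 0.
Proof.
move=> Uu; rewrite xiE lorentzE dotDr dotZr !dot_ysX XX// !(dotC (T _ u)) !XT// NX//.
rewrite !NT// (dotC (X u)) NX// NN//.
by field.
Qed.

Let ysys u : U u -> lorentz (ys u) (ys u) = 0.
Proof.
move=> Uu; rewrite lorentzE dot_ysX !(dotC _ (ysX u)) !dot_ysX.
rewrite XX// NN// !(dotC _ (X u)) !XT// !(dotC _ (N u)) !NT// NX//.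
rewrite -/(g 0 0 u) -/(g 1 1 u) -/(g 1 0 u) -/(g 0 1 u) gC.
have : 2 * q u = g 0 0 u * (a0 u * a0 u) + 2 * (g 0 1 u * (a0 u * a1 u))
  + g 1 1 u * (a1 u * a1 u) + h u * h u by rewrite /q mulVKf// pnatr_eq0.
move=> qE; transitivity (g 0 0 u * (a0 u * a0 u) + 2 * (g 0 1 u * (a0 u * a1 u))
  + g 1 1 u * (a1 u * a1 u) + h u * h u - 2 * q u); first by field.
by rewrite -qE subrr.
Qed.

(** Puts [ys] on the future half of the light cone, since its time component is [2^-1 + q u]. *)
Let q_ge0 u : U u -> 0 <= q u.
Proof.
move=> Uu; rewrite /q mulr_ge0// addr_ge0 -?expr2 ?sqr_ge0//.
have -> : g 0 0 u * a0 u ^+ 2 + 2 * (g 0 1 u * (a0 u * a1 u)) + g 1 1 u * (a1 u * a1 u)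
  = dot (a0 u *: T 0 u + a1 u *: T 1 u) (a0 u *: T 0 u + a1 u *: T 1 u).
  by rewrite !dot_lin (dotC (T 1 u)) /g; ring.
exact: dot_ge0.
Qed.

Let dot_ysX_Z k u : U u -> dot (ysX u) (Z k u) = pd k h u.
Proof.
move=> Uu; rewrite dot_ysX (dotC (X u)) ZX// (dotC (N u)) ZN// !(dotC (T _ u)).
rewrite -/(P k 0 u) -/(P k 1 u) !mulr0 add0r addr0 mulrC (mulrC (a1 u)).
by move: k; apply: ord2P; rewrite ?Psym ?aE0 ?aE1.
Qed.

Let ysX_X u : U u -> dot (ysX u) (X u) = q u - 2^-1.
Proof.
move=> Uu; rewrite dot_ysX XX// !(dotC (T _ u)) !XT// NX//.
by rewrite !mulr0 !addr0 mulr1.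
Qed.

Let ysxik k u : U u -> lorentz (ys u) (pd k xi u) = 0.
Proof.
move=> Uu; rewrite pd_xi// lorentzE dotDr dotZr dot_ysX_Z// ysX_X//.
by field.
Qed.

Let xiky k u : U u -> lorentz (pd k xi u) (y u) = 0.
Proof.
move=> Uu; rewrite pd_xi// lorentzE dotDl dotZl XX// ZX//.
by ring.
Qed.

Let yxi u : U u -> lorentz (y u) (xi u) = 0.
Proof.
move=> Uu; rewrite xiE lorentzE dotDr dotZr XX// dotC NX//.
by ring.
Qed.

Let xikxi k u : U u -> lorentz (pd k xi u) (xi u) = 0.
Proof.
move=> Uu; rewrite pd_xi// xiE lorentzE dotDr dotZr !(dotDl (_ *: X u)) !dotZl.
rewrite XX// ZX// ZN// (dotC (X u)) NX//.
by ring.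
Qed.

(** The null vector [y] is itself orthogonal to [xi], [y] and the xi_k, so a multiple of [y] is the
    best possible conclusion. Invertibility of [P] removes the tangential part of [v]. Both the
    uniqueness of y* and the nondegeneracy of the frame rest on this. *)
Let nondeg u v : U u -> lorentz v (xi u) = 0 -> lorentz v (y u) = 0 ->
  (forall k, lorentz v (pd k xi u) = 0) -> v = v.1 *: y u.
Proof.
case: v => t v Uu; rewrite xiE !lorentzE dotDr dotZr mulr1 => vxi vy vxik.
have vX : dot v (X u) = t by apply/eqP; rewrite -subr_eq0 addrC vy.
have vN : dot v (N u) = 0 by move: vxi; rewrite vX mulrC addKr.
have vZ k : dot (Z k u) v = 0.
  have := vxik k; rewrite pd_xi// lorentzE dotDr dotZr vX mulrC addKr.
  by rewrite dotC.
set t0 := dot v (T 0 u); set t1 := dot v (T 1 u).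
have e0 := Z_dot 0 v Uu; have e1 := Z_dot 1 v Uu.
rewrite vZ mulr0 -/t0 -/t1 in e0; rewrite vZ mulr0 -/t0 -/t1 (Psym Uu) in e1.
have dn0 := lt0r_neq0 (d_gt0 Uu); have Dn0 := D_neq0 Uu.
set e0r := (X in 0 = X) in e0; set e1r := (X in 0 = X) in e1.
have dDn0 : d u * D u != 0 by rewrite mulf_neq0.
have t00 : t0 = 0.
  apply: (mulfI dDn0); rewrite mulr0.
  (* Cramer's rule twice: first [P] is undone, at the price of the factor [D u], then the adjugate
     of the metric, at the price of [d u]. *)
  transitivity (g 0 0 u * (P 1 1 u * e0r - P 0 1 u * e1r)
                + g 0 1 u * (P 0 0 u * e1r - P 0 1 u * e0r)).
    by rewrite /e0r /e1r /d /D; ring.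
  by rewrite -e0 -e1 !(mulr0, subr0, addr0).
have t10 : t1 = 0.
  apply: (mulfI dDn0); rewrite mulr0.
  transitivity (g 0 1 u * (P 1 1 u * e0r - P 0 1 u * e1r)
                + g 1 1 u * (P 0 0 u * e1r - P 0 1 u * e0r)).
    by rewrite /e0r /e1r /d /D; ring.
  by rewrite -e0 -e1 !(mulr0, subr0, addr0).
have : v - t *: X u = 0.
  apply: (frame_eq0 (T := fun k => T k u) (XX Uu) (NN Uu) (NX Uu)).
  - by move=> j; exact: XT.
  - by move=> j; exact: NT.
  - by apply: lt0r_neq0; rewrite expr2; exact: d_gt0.
  - by rewrite dotDl dotNl dotZl XX// vX mulr1 subrr.
  - by rewrite dotDl dotNl dotZl vN dotC NX// mulr0 subrr.
  - move=> k; rewrite dotDl dotNl dotZl XT// mulr0 subr0.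
    by move: k; apply: ord2P.
by move=> /subr0_eq ->; congr (_, _); rewrite /= [RHS]mulr1.
Qed.

(** * Conformality of the Gauss map *)

Let lam u : R := - D u / d u.

Let lam_neq0 u : U u -> lam u != 0.
Proof.
move=> Uu; rewrite mulf_neq0 ?oppr_eq0 ?D_neq0// invr_eq0.
exact: lt0r_neq0 (d_gt0 Uu).
Qed.

(** Cayley-Hamilton for the trace-free endomorphism [g^-1 P]: its square is minus its determinant
    [D / d], which is [lam]. Entry by entry, the two sides differ by an entry of [P] times the trace
    relation. *)
Let ZZ i j u : U u -> dot (Z i u) (Z j u) = lam u * g i j u.
Proof.
move=> Uu; have dn0 := lt0r_neq0 (d_gt0 Uu).
apply: (mulfI dn0); rewrite Z_dot// -/(P j 0 u) -/(P j 1 u).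
rewrite /lam mulrA mulrCA mulfV// mulr1 mulrC.
have tr := trP Uu.
move: i j; apply: ord2P; apply: ord2P; rewrite ?gC ?(Psym Uu)//; apply/eqP;
  rewrite -subr_eq0.
- by rewrite -(mulr0 (P 0 0 u)) -tr /D; apply/eqP; ring.
- by rewrite -(mulr0 (P 0 1 u)) -tr /D; apply/eqP; ring.
- by rewrite -(mulr0 (P 0 1 u)) -tr /D; apply/eqP; ring.
- by rewrite -(mulr0 (P 1 1 u)) -tr /D; apply/eqP; ring.
Qed.

Let norm2E u : U u -> tensor_norm2 (I u) (II u - h u *: I u) = 2 * lam u.
Proof.
move=> Uu; have dn0 := lt0r_neq0 (d_gt0 Uu).
rewrite IIoE// /tensor_norm2 /mxtrace sum_ord2.
do 4![rewrite ?mxE ?sum_ord2].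
have [-> -> -> ->] := invI Uu; rewrite (Psym Uu).
have tr := trP Uu.
(* For [A = g^-1 P] one has [tr (A^2) = (tr A)^2 - 2 det A]; inserting the vanishing [(tr A)^2]
   makes the claim a rational identity. *)
have -> : 2 * lam u = 2 * lam u + (g 1 1 u * P 0 0 u - 2 * g 0 1 u * P 0 1 u +
  g 0 0 u * P 1 1 u) ^+ 2 / d u ^+ 2.
  by rewrite tr expr2 mul0r mul0r addr0.
by rewrite /lam /D; move: dn0; rewrite /d => dn0; field.
Qed.

Let dG i j u : U u -> differentiable (G i j) u.
Proof.
have dq (f : 'rV[R]_2 -> R^o) u' : U u' -> differentiable f u' ->
    differentiable (fun v => f v * (s v)^-1 : R^o) u'.
  move=> Uu' df; apply: differentiable_mul => //.
  by apply: differentiableV; [exact: ds|exact: s_neq0].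
move=> Uu; move: i j; apply: ord2P; apply: ord2P.
- apply: (differentiable_on U_open Uu _ (dq _ _ Uu (dg 1 1 Uu))) => v Uv.
  by have [->] := GE Uv.
- apply: (differentiable_on U_open Uu _ (dq _ _ Uu (differentiableN (dg 0 1
    Uu)))) => v Uv.
  by have [_ ->] := GE Uv.
- apply: (differentiable_on U_open Uu _ (dq _ _ Uu (differentiableN (dg 0 1
    Uu)))) => v Uv.
  by have [_ _ ->] := GE Uv.
- apply: (differentiable_on U_open Uu _ (dq _ _ Uu (dg 0 0 Uu))) => v Uv.
  by have [_ _ _ ->] := GE Uv.
Qed.

(** * The Willmore operator as a trace *)

Let laplaceE u : U u -> s u * laplace_beltrami I h u =
  (pd 0 (G 0 0) u + pd 1 (G 1 0) u) * pd 0 h u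
  + (pd 0 (G 0 1) u + pd 1 (G 1 1) u) * pd 1 h u
  + (G 0 0 u * pd 0 (pd 0 h) u + G 0 1 u * pd 0 (pd 1 h) u
     + (G 1 0 u * pd 1 (pd 0 h) u + G 1 1 u * pd 1 (pd 1 h) u)).
Proof.
move=> Uu; rewrite /laplace_beltrami detE mulVKf ?s_neq0// sum_ord2.
have divE i : pd i (fun v => Num.sqrt (\det (I v)) *
    (\sum_(j < 2) invmx (I v) i j * partial j h v) : R^o) u =
  pd i (G i 0) u * pd 0 h u + G i 0 u * pd i (pd 0 h) u
  + (pd i (G i 1) u * pd 1 h u + G i 1 u * pd i (pd 1 h) u).
  transitivity (pd i (fun v => G i 0 v * pd 0 h v + G i 1 v * pd 1 h v : R^o) u).
    by congr (pd i _ u); apply/funext => v; rewrite sum_ord2 -!pdE /G; ring.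
  have [dG0 dG1] := (dG i 0 Uu, dG i 1 Uu).
  have [dh0 dh1] := (dhk 0 Uu, dhk 1 Uu).
  rewrite pd_add; [|exact: differentiable_mul..].
  by rewrite (pd_mul i dG0 dh0) (pd_mul i dG1 dh1).
by rewrite -!pdE !divE; ring.
Qed.

(** The derivative is moved from [ys] to the xi_l, so no derivative of [a0], [a1] or [q] occurs. *)
Let ys_xi k l u : U u -> lorentz (pd k ys u) (pd l xi u) =
  pd k (pd l h) u - pd l h u * (a0 u * g 0 k u + a1 u * g 1 k u)
  + (q u - 2^-1) * P l k u - a0 u * z l k 0 u - a1 u * z l k 1 u
  + h u * (lam u * g l k u - h u * P l k u).
Proof.
move=> Uu; pose xl v : R14 (R := R) := (pd l h v, pd l h v *: X v + Z l v).
have dlX : differentiable (fun v => pd l h v *: X v) u.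
  by apply: differentiable_scale; [exact: dhk|exact: dX].
have dxl2 : differentiable (fun v => pd l h v *: X v + Z l v) u.
  exact: (differentiableD dlX (dZ l Uu)).
have dxl : differentiable xl u by apply: differentiable_pair => //; exact: dhk.
have pd_xl : pd k xl u = (pd k (pd l h) u,
    pd k (pd l h) u *: X u + pd l h u *: T k u + pd k (Z l) u).
  rewrite (pd_pair k (dhk l Uu) dxl2) (pd_add k dlX (dZ l Uu)).
  by rewrite pd_scale; [|exact: dhk|exact: dX].
have ysxl v : U v -> lorentz (ys v) (xl v) = 0 by move=> Uv; rewrite /xl -pd_xi// ysxik.
have := pd_cst_on U_open k Uu ysxl.
rewrite pd_lorentz//; last exact: dys.
rewrite /xl -pd_xi// -/xl => /eqP; rewrite addr_eq0 => /eqP ->.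
rewrite pd_xl lorentzE dotDr (dotDr (_ *: X u)) !dotZr ysX_X// !dot_ysX.
rewrite XT// NT// (dotC (X u)) zX// (dotC (N u)) zN// ZZ//.
rewrite -/(g 0 k u) -/(g 1 k u) !(dotC (T _ u)) -/(z l k 0 u) -/(z l k 1 u).
by field.
Qed.

Let subr0_eq0 (a b : R) : a = b -> a - b = 0. Proof. by move=> ->; exact: subrr. Qed.

(** After contraction with [G], the second derivatives of [h] in [ys_xi] give the second order part
    of the Laplacian. Because [P a = dh], its first order part comes from [codazzi0] and [codazzi1]
    weighted by [a0] and [a1]; their right-hand sides cancel the products of [dh] with [a]. The [P]
    terms vanish by trace-freeness, and the [lam] term leaves [2 * lam * h], which is |IIo|^2 H. *)
Let traceE u : U u ->
  G 0 0 u * lorentz (pd 0 ys u) (pd 0 xi u) + G 0 1 u * lorentz (pd 0 ys u) (pd 1 xi u)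
  + G 1 0 u * lorentz (pd 1 ys u) (pd 0 xi u) + G 1 1 u * lorentz (pd 1 ys u)
    (pd 1 xi u)
  = s u * (laplace_beltrami I h u + tensor_norm2 (I u) (II u - h u *: I u) * h u).
Proof.
move=> Uu; rewrite norm2E// [RHS]mulrDr laplaceE// !ys_xi// !gC !Psym//.
have sn0 := s_neq0 Uu; have sd2 := s2 Uu; rewrite /d in sd2.
have C0 := codazzi0 Uu; have C1 := codazzi1 Uu.
have A0 := aE0 Uu; have A1 := aE1 Uu.
have [G00 G01 G10 G11] := GE Uu.
have K00 : G 0 0 u * g 0 0 u + G 1 0 u * g 0 1 u = s u.
  by rewrite G00 G10; apply: (mulIf sn0); rewrite sd2; field.
have K01 : G 0 0 u * g 0 1 u + G 1 0 u * g 1 1 u = 0 by rewrite G00 G10; field.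
have K10 : G 0 1 u * g 0 0 u + G 1 1 u * g 0 1 u = 0 by rewrite G01 G11; field.
have K11 : G 0 1 u * g 0 1 u + G 1 1 u * g 1 1 u = s u.
  by rewrite G01 G11; apply: (mulIf sn0); rewrite sd2; field.
have KP : G 0 0 u * P 0 0 u + G 0 1 u * P 0 1 u + G 1 0 u * P 0 1 u + G 1 1 u *
  P 1 1 u = 0.
  rewrite G00 G01 G10 G11 -(mul0r (s u)^-1) -(trP Uu); ring.
(* From here on [G] enters only through the contractions just recorded and the Codazzi relations, so
   its entries and their derivatives become free variables. *)
clear G00 G01 G10 G11.
move: (G 0 0 u) (G 0 1 u) (G 1 0 u) (G 1 1 u) C0 C1 K00 K01 K10 K11 KP => G00
  G01 G10 G11.
move: (pd 0 (G 0 0) u) (pd 1 (G 1 0) u) (pd 0 (G 0 1) u) (pd 1 (G 1 1) u).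
move=> dG0 dG1 dG2 dG3 C0 C1 K00 K01 K10 K11 KP.
apply/eqP; rewrite -subr_eq0; apply/eqP.
move: C0 C1 A0 A1 K00 K01 K10 K11 KP.
move=> /subr0_eq0 C0 /subr0_eq0 C1 /subr0_eq0 A0 /subr0_eq0 A1.
move=> /subr0_eq0 K00 K01 K10 /subr0_eq0 K11 KP.
set c0 := (X in X = 0) in C0; set c1 := (X in X = 0) in C1.
set b0 := (X in X = 0) in A0; set b1 := (X in X = 0) in A1.
set k00 := (X in X = 0) in K00; set k11 := (X in X = 0) in K11.
set k01 := (X in X = 0) in K01; set k10 := (X in X = 0) in K10.
set kP := (X in X = 0) in KP.
(* The difference of the two sides as an explicit combination of expressions known to vanish. *)
transitivity (- a0 u * c0 - a1 u * c1 + (dG0 + dG1) * b0 + (dG2 + dG3) * b1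
  + (q u - 2^-1 - h u ^+ 2) * kP + h u * lam u * (k00 + k11)
  - pd 0 h u * a0 u * k00 - pd 0 h u * a1 u * k01
  - pd 1 h u * a0 u * k10 - pd 1 h u * a1 u * k11); last first.
  by rewrite C0 C1 A0 A1 K00 K01 K10 K11 KP !(mulr0, addr0, subr0).
rewrite /c0 /c1 /b0 /b1 /kP /k00 /k01 /k10 /k11; ring.
Qed.

Let y_xik k l u : U u -> lorentz (pd k y u) (pd l xi u) = P l k u.
Proof.
move=> Uu; rewrite pd_y// pd_xi// lorentzE mul0r oppr0 add0r dotDr dotZr dotC XT//.
by rewrite mulr0 add0r dotC.
Qed.

Let yk_xi k u : U u -> lorentz (pd k y u) (xi u) = 0.
Proof.
move=> Uu; rewrite pd_y// xiE lorentzE mul0r oppr0 add0r dotDr dotZr dotC XT//.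
by rewrite mulr0 add0r dotC NT.
Qed.

Let dxi u : U u -> differentiable xi u.
Proof.
move=> Uu; apply: differentiableD.
  exact: (differentiable_scale (dh Uu) (dy Uu)).
exact: (differentiable_pair (differentiable_cst _ _) (dN Uu)).
Qed.

Let ysk_xi k u : U u -> lorentz (pd k ys u) (xi u) = 0.
Proof.
move=> Uu; have := pd_cst_on U_open k Uu ysxi.
by rewrite (pd_lorentz k (dys Uu) (dxi Uu)) ysxik// addr0.
Qed.

Let E u : 'M[R]_2 := \matrix_(k, l) lorentz (pd k xi u) (pd l xi u).

Let EE u : U u -> E u = lam u *: I u.
Proof.
move=> Uu; apply/matrixP => k l; rewrite [LHS]mxE [RHS]mxE IE !pd_xi// lorentzE.
rewrite !(dotDl (_ *: X u)) !(dotDr (_ *: X u)) !dotZl !dotZr XX// ZX// (dotC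
  (X u)) ZX//.
by rewrite ZZ//; ring.
Qed.

Let uE u : U u -> E u \in unitmx.
Proof.
move=> Uu; rewrite EE// unitmxZ ?unitfE ?lam_neq0// unitmxE unitfE.
exact: lt0r_neq0 (det_gt0 Uu).
Qed.

Let C rho u : 'M[R]_2 :=
  \matrix_(k, l) lorentz (pd k y u + rho *: pd k ys u) (pd l xi u).

Let W u := laplace_beltrami I h u + tensor_norm2 (I u) (II u - h u *: I u) * h u.

Let trace_C rho u : U u -> \tr (C rho u *m invmx (E u)) = (lam u)^-1 * rho * W u.
Proof.
move=> Uu; have sn0 := s_neq0 Uu; have dn0 := lt0r_neq0 (d_gt0 Uu).
have uI : lam u *: I u \in unitmx by rewrite -EE// uE.
rewrite EE// invmxZ// -scalemxAr mxtraceZ -[RHS]mulrA; congr (_ * _).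
apply: (mulfI sn0); rewrite [RHS]mulrCA -traceE//.
have CE k l : C rho u k l = P l k u + rho * lorentz (pd k ys u) (pd l xi u).
  by rewrite mxE lorentzDl lorentzZl y_xik.
rewrite /mxtrace sum_ord2 ![(C rho u *m _) _ _]mxE !sum_ord2 !CE.
have [-> -> -> ->] := invI Uu; have [-> -> -> ->] := GE Uu.
rewrite (Psym Uu) -(s2 Uu); have tr := trP Uu.
apply/eqP; rewrite -subr_eq0 -(mul0r (s u)^-1) -tr; apply/eqP.
by field.
Qed.

(* [det (C rho)] is a quadratic polynomial in [rho] with value [D] at 0, so it
   does not vanish at all three of [rho = 1, 2, 3]. *)
Let det_C u : U u -> exists2 rho, 0 < rho & C rho u \in unitmx.
Proof.
move=> Uu; pose Y k l := lorentz (pd k ys u) (pd l xi u).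
have CE rho k l : C rho u k l = P l k u + rho * Y k l.
  by rewrite mxE lorentzDl lorentzZl y_xik.
have detC rho : \det (C rho u) = D u
    + rho * (P 0 0 u * Y 1 1 + P 1 1 u * Y 0 0 - P 0 1 u * (Y 0 1 + Y 1 0))
    + rho ^+ 2 * (Y 0 0 * Y 1 1 - Y 0 1 * Y 1 0).
  by rewrite det_mx2 !CE (Psym Uu) /D; ring.
have [rho [rho0 /negP Crho]] : exists rho, 0 < rho /\ ~ (\det (C rho u) == 0).
  apply: contrapT => /forallNP H.
  have H' rho : 0 < rho -> \det (C rho u) = 0.
    move=> r0; have := H rho; rewrite not_andP notK => -[//|/eqP//].
  have := D_neq0 Uu; apply/negP; rewrite negbK; apply/eqP.
  (* The third difference of a quadratic polynomial vanishes, so this combination is its value at 0,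
     namely [D u]. *)
  transitivity (3 * \det (C 1 u) - 3 * \det (C 2 u) + \det (C 3 u)).
    by rewrite !detC; ring.
  by rewrite !H'// mulr0 subr0 addr0.
by exists rho => //; rewrite unitmxE unitfE.
Qed.

(** [ys] is exported through its characterising conditions, which is what the comparison with the
    pointwise choice [dual_lift] requires. The 4-surface enters only through vectors [F] and [Xi] at
    one point, so the actual partial derivatives can be substituted later. *)
Lemma chart_willmore_minimal : exists ys : 'rV[R]_2 -> R14 (R := R),
  let y := fun u => (1, X u) : R14 (R := R) in
  let xi := fun u => h u *: y u + ((0, N u) : R14 (R := R)) in
  [/\ forall u, U u -> differentiable ys u /\ differentiable xi u,
      forall u, U u -> [/\ light_cone (ys u), lorentz (ys u) (y u) = -1,
        lorentz (ys u) (xi u) = 0 & forall k, lorentz (ys u) (pd k xi u) = 0],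
      forall u v, U u -> lorentz v v = 0 -> lorentz v (y u) = -1 ->
        lorentz v (xi u) = 0 -> (forall k, lorentz v (pd k xi u) = 0) -> v = ys u &
      forall u, U u ->
        laplace_beltrami (first_form (@dot R) X) h u
        + tensor_norm2 (first_form (@dot R) X u)
            (second_form (@dot R) X N u - h u *: first_form (@dot R) X u) * h u = 0 <->
        forall (alpha rho : R) (F Xi : 'I_(2 + 2) -> R14 (R := R)),
          0 < alpha -> 0 < rho ->
          F (lshift 2 0) = y u + rho *: ys u -> F (lshift 2 1) = alpha *: ys u ->
          (forall k, F (rshift 2 k) = alpha *: (pd k y u + rho *: pd k ys u)) ->
          (forall k, Xi (lshift 2 k) = 0) -> (forall k, Xi (rshift 2 k) = pd k xi u) ->
          let g := \matrix_(i, j) lorentz (F i) (F j) in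
          g \in unitmx ->
          \tr (invmx g *m \matrix_(i, j) - lorentz (F i) (Xi j)) = 0].
Proof.
exists ys; split.
- by move=> u Uu; split; [exact: dys|exact: dxi].
- move=> u Uu; split=> //; [|exact: ysy|exact: ysxi|by move=> k; exact: ysxik].
  by split; [exact: ysys|rewrite /= ltr_wpDr// q_ge0].
- move=> u v Uu vv vy vxi vxik; apply/subr0_eq.
  (* By [nondeg], [v = ys u + t *: y u]; nullity of [v] then reads [- 2 t = 0]. *)
  have vysE : v - ys u = (v - ys u).1 *: y u.
    apply: nondeg => //.
    + by rewrite lorentzDl lorentzNl vxi ysxi// subrr.
    + by rewrite lorentzDl lorentzNl vy ysy// subrr.
    + by move=> k; rewrite lorentzDl lorentzNl vxik ysxik// subrr.
  set t := (v - ys u).1 in vysE.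
  have vE : v = ys u + t *: y u by rewrite -vysE addrC subrK.
  have t0 : t = 0.
    move: vv; rewrite vE !lorentz_lin ysys// yy// (lorentzC (y u)) ysy//.
    by rewrite !mulr0 addr0 add0r mulrN1 => /eqP; rewrite -opprD oppr_eq0
      -mulr2n mulrn_eq0 => /eqP.
  by rewrite vysE t0 scale0r.
move=> u Uu.
have nondeg' v : lorentz v (xi u) = 0 -> lorentz v (y u) = 0 -> lorentz v (ys u) = 0 ->
    (forall k, lorentz v (pd k xi u) = 0) -> v = 0.
  move=> vxi vy vys vxik; have vE := nondeg Uu vxi vy vxik.
  move: vys; rewrite vE lorentzZl (lorentzC (y u)) ysy// mulrN1 => /eqP.
  by rewrite oppr_eq0 => /eqP ->; rewrite scale0r.
have xiy k := xiky k Uu.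
have xiys k : lorentz (pd k xi u) (ys u) = 0 by rewrite lorentzC ysxik.
have key alpha rho F Xi al0 := trace_associate (yy Uu) (ysys Uu) (ysy Uu) xiy xiys
  (yxi Uu) (ysxi Uu) (fun k => xikxi k Uu) nondeg' (uE Uu) (alpha := alpha)
  (rho := rho) (y' := fun k => pd k y u) (ys' := fun k => pd k ys u) (F := F)
    (Xi := Xi) al0.
split=> [W0 alpha rho F Xi al0 r0 F0 F1 F2 Xi1 Xi2 gF gu|minimal].
  have [_ K] := key alpha rho F Xi al0 F0 F1 F2 Xi1 Xi2 (fun k => yk_xi k Uu)
    (fun k => ysk_xi k Uu).
  by apply/(K gu); rewrite -/(C rho u) trace_C// /W W0 mulr0.
(* Minimality says nothing where the first form degenerates, so [rho] is chosen to make [C]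
   invertible; [alpha = 1] is enough. *)
have [rho r0 uC] := det_C Uu.
pose F (i : 'I_(2 + 2)) : R14 (R := R) := match fintype.split i with
  | inl k => if k == 0 then y u + rho *: ys u else 1 *: ys u
  | inr k => 1 *: (pd k y u + rho *: pd k ys u) end.
pose Xi (i : 'I_(2 + 2)) : R14 (R := R) := match fintype.split i with
  | inl k => 0 | inr k => pd k xi u end.
have splitl (k : 'I_2) : fintype.split (lshift 2 k) = inl k := unsplitK (inl k).
have splitr (k : 'I_2) : fintype.split (rshift 2 k) = inr k := unsplitK (inr k).
have F0 : F (lshift 2 0) = y u + rho *: ys u by rewrite /F splitl eqxx.
have F1 : F (lshift 2 1) = 1 *: ys u by rewrite /F splitl.
have F2 k : F (rshift 2 k) = 1 *: (pd k y u + rho *: pd k ys u) by rewrite /F splitr.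
have Xi1 k : Xi (lshift 2 k) = 0 by rewrite /Xi splitl.
have Xi2 k : Xi (rshift 2 k) = pd k xi u by rewrite /Xi splitr.
have [gu K] := key 1 rho F Xi ltr01 F0 F1 F2 Xi1 Xi2 (fun k => yk_xi k Uu)
    (fun k => ysk_xi k Uu).
have := minimal 1 rho F Xi ltr01 r0 F0 F1 F2 Xi1 Xi2 (gu uC).
move=> /(K (gu uC)); rewrite -/(C rho u) trace_C// => /eqP.
by rewrite !mulf_eq0 invr_eq0 (negPf (lam_neq0 Uu)) (gt_eqF r0)/= => /eqP.
Qed.

End Chart.

(** * Change of chart *)

Section ChangeOfChart.
Context {R : realType}.

Lemma pd_chain (m l : nat) (V : normedModType R) (f : 'rV[R]_l -> V)
    (phi : 'rV[R]_m -> 'rV[R]_l) k u :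
  differentiable phi u -> differentiable f (phi u) ->
  pd k (f \o phi) u = \sum_(j < l) pd k phi u 0 j *: pd j f (phi u).
Proof.
move=> dphi df; rewrite !pdE !partialE//; last exact: differentiable_comp.
rewrite diff_comp//= [X in 'd f _ X]row_sum_delta linear_sum/=.
by apply: eq_bigr => j _; rewrite linearZ/= pdE partialE.
Qed.

(** A change of coordinates acts on both fundamental forms by congruence, hence on [invmx g *m b] by
    conjugation, which preserves the trace. *)
Lemma mxtrace_congruence (A g b : 'M[R]_2) : A *m g *m A^T \in unitmx ->
  \tr (invmx (A *m g *m A^T) *m (A *m b *m A^T)) = \tr (invmx g *m b).
Proof.
move=> u; have := u; rewrite !unitmx_mul unitmx_tr => /andP[/andP[uA ug] _].
have -> : invmx (A *m g *m A^T) *m (A *m b *m A^T) = invmx A^T *m (invmx g *m b) *m A^T.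
  rewrite -[RHS](mulKmx u); congr (_ *m _).
  by rewrite !mulmxA mulmxK ?unitmx_tr// mulmxK.
by rewrite mxtrace_mulC mulKVmx ?unitmx_tr.
Qed.

(** [B] is a bare function so that [- dot], as it occurs in the second fundamental form, is covered
    along with [dot]. *)
Lemma form_congruence (V : normedModType R) (B : V -> V -> R) (f f' g g' : 'I_2
  -> V) (A : 'M[R]_2) :
  (forall a v w z, B (a *: v + w) z = a * B v z + B w z) ->
  (forall a v w z, B z (a *: v + w) = a * B z v + B z w) ->
  (forall k, f k = \sum_l A k l *: f' l) -> (forall k, g k = \sum_l A k l *: g' l) ->
  \matrix_(i, j) B (f i) (g j) = A *m (\matrix_(i, j) B (f' i) (g' j)) *m A^T.
Proof.
move=> Bl Br fE gE; apply/matrixP => i j; rewrite mxE fE gE.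
have B0l z : B 0 z = 0.
  by have := Bl (-1) 0 0 z; rewrite scaler0 addr0 mulN1r addNr.
have B0r z : B z 0 = 0.
  by have := Br (-1) 0 0 z; rewrite scaler0 addr0 mulN1r addNr.
rewrite !sum_ord2 !mxE !sum_ord2 !mxE !sum_ord2 !mxE.
rewrite Bl -[A i 1 *: _]addr0 Bl B0l !Br -[A j 1 *: _]addr0 !Br !B0r.
by ring.
Qed.

End ChangeOfChart.

(** * From the charts to the surface *)

Section Global.
Context {R : realType} {M : surface R}.

Lemma transition_near (i j : chart M) u v : dom i u -> dom j v ->
  param i u = param j v ->
  [/\ \forall u' \near u, param i u' = param j (Defs.coord j (param i u')),
      differentiable (Defs.coord j \o @param R M i) u &
      (Defs.coord j \o @param R M i) u = v].
Proof.
move=> iu jv uv.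
have im : (param j @` dom j) (param i u) by exists v.
split; last by rewrite /= uv paramK.
  have : nbhs (param i u) (param j @` dom j).
    by apply: open_nbhs_nbhs; split=> //; exact: open_param.
  move=> /(param_continuous iu) H.
  have sub : (param i @^-1` (param j @` dom j)) `<=`
      [set u' | param i u' = param j (Defs.coord j (param i u'))].
    by move=> u' /= [v' jv' <-]; rewrite paramK.
  exact: filterS sub H.
have := @smooth_transition _ M i j 1%N; case=> + _; apply; split=> //.
Qed.

Lemma pd_transition (V : normedModType R) (f : M -> V) (i j : chart M) u v k :
  dom i u -> dom j v -> param i u = param j v ->
  differentiable (f \o @param R M j) v ->
  pd k (f \o @param R M i) u =
  \sum_l pd k (Defs.coord j \o @param R M i) u 0 l *: pd l (f \o @param R M j) v.
Proof.
move=> iu jv uv df; have [near dphi phiu] := transition_near iu jv uv.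
transitivity (pd k ((f \o @param R M j) \o (Defs.coord j \o @param R M i)) u).
  by rewrite !pdE; apply: near_eq_partial; apply: filterS near => u' /= {1}->.
rewrite -phiu in df *; exact: (pd_chain (f := f \o @param R M j) k dphi df).
Qed.

Context (x n : M -> 'rV[R]_4).
Hypotheses (x_immersion : immersion_S3 x) (n_normal : unit_normal x n).
Hypothesis no_umbilic : forall p, ~ umbilical x n p.

Let sX i : smooth_on (dom i) (x \o @param R M i).
Proof. by have [sx _ _] := x_immersion; exact: sx. Qed.

Let sN i : smooth_on (dom i) (n \o @param R M i).
Proof. by have [sn _ _ _] := n_normal; exact: sn. Qed.

Let det_gt0 i u : dom i u -> 0 < \det (surf_I x i u).
Proof.
move=> iu.
have IE a b : surf_I x i u a b =
    dot (pd a (x \o @param R M i) u) (pd b (x \o @param R M i) u).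
  by rewrite mxE -!pdE.
rewrite det_mx2 !IE (dotC (pd 1 _ _)) -expr2.
have dX := smooth_differentiable (sX i) iu.
apply: gram_det_gt0 => a b; rewrite !pdE !partialE// -!linearZ -linearD/= => ab0.
have [_ _ inj] := x_immersion.
have e0 : a *: delta_mx 0 0 + b *: delta_mx 0 1 = 0 :> 'rV[R]_2.
  by apply: (inj i u iu); rewrite ab0 linear0.
have := congr1 (fun w : 'rV[R]_2 => (w 0 0, w 0 1)) e0.
by rewrite !mxE/= !mulr1 !mulr0 addr0 add0r => -[].
Qed.

(** The chart in which [surf_H] is computed may change from point to point; this brings the formula
    back to a fixed chart, as the hypothesis [hE] of the local analysis demands. *)
Lemma surf_H_chart i u : dom i u ->
  surf_H x n (param i u) = 2^-1 * \tr (invmx (surf_I x i u) *m surf_II x n i u).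
Proof.
move=> iu; rewrite /surf_H; set j := chart_at _.
have [v jv vE] := @chart_at_cover R M (param i u); rewrite -/j in jv vE.
(* The way [j] was selected is forgotten: the comparison is between any two charts around the
   point. *)
clearbody j.
have -> : Defs.coord j (param i u) = v.
  exact: etrans (congr1 (Defs.coord j) (esym vE)) (paramK jv).
suff trE : \tr (invmx (surf_I x j v) *m surf_II x n j v) =
    \tr (invmx (surf_I x i u) *m surf_II x n i u).
  exact: (congr1 (fun t : R => 2^-1 * t) trE).
have dx := smooth_differentiable (sX j) jv.
have dn := smooth_differentiable (sN j) jv.
pose A := \matrix_(k, l) pd k (Defs.coord j \o @param R M i) u 0 l.
have xE k : partial k (x \o @param R M i) u = \sum_l A k l *: partial l (x \o
  @param R M j) v.
  rewrite -!pdE (pd_transition k iu jv (esym vE) dx).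
  by apply: eq_bigr => l _; rewrite [A k l]mxE -pdE.
have nE k : partial k (n \o @param R M i) u = \sum_l A k l *: partial l (n \o
  @param R M j) v.
  rewrite -!pdE (pd_transition k iu jv (esym vE) dn).
  by apply: eq_bigr => l _; rewrite [A k l]mxE -pdE.
have IE : surf_I x i u = A *m surf_I x j v *m A^T.
  by apply: form_congruence => //= *; rewrite !dot_lin.
have IIE : surf_II x n i u = A *m surf_II x n j v *m A^T.
  apply: (form_congruence (B := fun v w => - dot v w)) => //= *;
    rewrite !dot_lin opprD mulrN//.
rewrite IE IIE mxtrace_congruence// -IE unitmxE unitfE.
exact: lt0r_neq0 (det_gt0 iu).
Qed.

Let IIo_neq0 i u : dom i u ->
  surf_II x n i u - surf_H x n (param i u) *: surf_I x i u != 0.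
Proof.
move=> iu; apply/eqP => u0; apply: (no_umbilic (p := param i u)).
by exists i; split; [exists u|rewrite paramK].
Qed.

Let XX i u : dom i u -> dot ((x \o @param R M i) u) ((x \o @param R M i) u) = 1.
Proof. by have [_ xx _] := x_immersion => _; exact: xx. Qed.

Let NN i u : dom i u -> dot ((n \o @param R M i) u) ((n \o @param R M i) u) = 1.
Proof. by have [_ nn _ _] := n_normal => _; exact: nn. Qed.

Let NX i u : dom i u -> dot ((n \o @param R M i) u) ((x \o @param R M i) u) = 0.
Proof. by have [_ _ nx _] := n_normal => _; exact: nx. Qed.

Let NT i u k : dom i u ->
  dot ((n \o @param R M i) u) (pd k (x \o @param R M i) u) = 0.
Proof. by have [_ _ _ nt] := n_normal => iu; rewrite pdE; exact: nt. Qed.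

Let chart_result i := chart_willmore_minimal (@open_dom R M i) (sX i) (sN i)
  (@XX i) (@NN i) (@NX i) (@NT i) (@det_gt0 i) (@surf_H_chart i) (@IIo_neq0 i).

(** [dual_vectors] asks for orthogonality in every chart. The chain rule carries it from chart [i]
    to the others, so the set is nonempty and [xget] picks a member; uniqueness in chart [i] alone
    then identifies that member. *)
Lemma dual_lift_chart i (ys : 'rV[R]_2 -> R14) u : dom i u ->
  (forall v, dom i v -> differentiable (gauss_map x n \o @param R M i) v) ->
  light_cone (ys u) -> lorentz (ys u) (lightlift x (param i u)) = -1 ->
  lorentz (ys u) (gauss_map x n (param i u)) = 0 ->
  (forall k, lorentz (ys u) (pd k (gauss_map x n \o @param R M i) u) = 0) ->
  (forall v, lorentz v v = 0 -> lorentz v (lightlift x (param i u)) = -1 ->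
     lorentz v (gauss_map x n (param i u)) = 0 ->
     (forall k, lorentz v (pd k (gauss_map x n \o @param R M i) u) = 0) -> v = ys u) ->
  dual_lift x n (param i u) = ys u.
Proof.
move=> iu dxi cone ysy ysxi ysxik uniq.
have dual_ys : dual_vectors x n (param i u) (ys u).
  split=> // j v k jv uv; rewrite -pdE.
  rewrite (pd_transition k jv iu uv (dxi u iu)) sum_ord2.
  by rewrite lorentzDr !lorentzZr !ysxik !mulr0 addr0.
have [] : dual_vectors x n (param i u) (dual_lift x n (param i u)).
  by apply: xgetPex; exists (ys u).
move=> [vv _] vy vxi vxik; apply: uniq => // k; rewrite pdE.
exact: vxik.
Qed.

Lemma rsubmx_delta_l (j : 'I_2) :
  rsubmx (delta_mx 0 (lshift 2 j) : 'rV[R]_(2 + 2)) = 0.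
Proof. by apply/rowP => l; rewrite !mxE eq_rlshift andbF. Qed.

Lemma rsubmx_delta_r (j : 'I_2) :
  rsubmx (delta_mx 0 (rshift 2 j) : 'rV[R]_(2 + 2)) = delta_mx 0 j.
Proof. by apply/rowP => l; rewrite !mxE eq_rshift. Qed.

Lemma differentiable_rsubmx_comp (V : normedModType R) (f : 'rV[R]_2 -> V)
    (w : 'rV[R]_(2 + 2)) : differentiable f (rsubmx w) ->
  differentiable (fun v : 'rV[R]_(2 + 2) => f (rsubmx v)) w.
Proof.
move=> df; apply: (@differentiable_comp _ _ _ _ (rsubmx : 'rV[R]_(2 + 2) ->
  'rV[R]_2) f) => //.
exact: differentiable_rsubmx.
Qed.

Lemma pd_rsubmx_comp (V : normedModType R) (f : 'rV[R]_2 -> V)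
    (w : 'rV[R]_(2 + 2)) : differentiable f (rsubmx w) ->
  (forall j, pd (lshift 2 j) (fun v : 'rV[R]_(2 + 2) => f (rsubmx v)) w = 0) /\
  (forall j, pd (rshift 2 j) (fun v : 'rV[R]_(2 + 2) => f (rsubmx v)) w =
     pd j f (rsubmx w)).
Proof.
move=> df.
have pdfE k : pd k (fun v : 'rV[R]_(2 + 2) => f (rsubmx v)) w =
    'd f (rsubmx w) (rsubmx (delta_mx 0 k : 'rV[R]_(2 + 2))).
  rewrite pdE partialE; last exact: differentiable_rsubmx_comp.
  rewrite (@diff_comp _ _ _ _ (rsubmx : 'rV[R]_(2 + 2) -> 'rV[R]_2) f)//=; last first.
    exact: differentiable_rsubmx.
  by rewrite diff_lin//; exact: continuous_rsubmx.
split=> j; rewrite pdfE; first by rewrite rsubmx_delta_l linear0.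
by rewrite rsubmx_delta_r pdE partialE.
Qed.

Lemma associate_partials i (ys : 'rV[R]_2 -> R14) (w : 'rV[R]_(2 + 2)) :
  (forall u, dom i u -> dual_lift x n (param i u) = ys u) ->
  (forall u, dom i u -> differentiable ys u) -> dom i (rsubmx w) ->
  let y := fun u => (1, (x \o @param R M i) u) : R14 (R := R) in
  let F k := pd k (in_chart4 i (associate_surface x n)) w in
  [/\ F (lshift 2 0) = y (rsubmx w) + lsubmx w 0 1 *: ys (rsubmx w),
      F (lshift 2 1) = lsubmx w 0 0 *: ys (rsubmx w) &
      forall k, F (rshift 2 k) =
        lsubmx w 0 0 *: (pd k y (rsubmx w) + lsubmx w 0 1 *: pd k ys (rsubmx w))].
Proof.
move=> ysE dys wi y F.
have dy : differentiable y (rsubmx w).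
  apply: differentiable_pair; first exact: differentiable_cst.
  exact: (smooth_differentiable (sX i) wi).
have dysw := dys _ wi.
pose c (j : 'I_2) (v : 'rV[R]_(2 + 2)) : R^o := v 0 (lshift 2 j).
have dc j v : differentiable (c j) v by exact: differentiable_coord.
have pd_c k j v : pd k (c j) v = (delta_mx 0 k : 'rV[R]_(2 + 2)) 0 (lshift 2 j).
  have did : differentiable (id : 'rV[R]_(2 + 2) -> _) v by exact: ex_diff.
  rewrite /c (@pd_coord _ _ _ id)// pdE partialE//.
  by rewrite diff_val.
(* The equality of [dual_lift] with the differentiable [ys] holds over [dom i]; that it holds in a
   whole neighbourhood of [w] is what lets it pass to derivatives. *)
have near_w : nbhs w (rsubmx @^-1` dom i).
  apply: (differentiable_continuous (differentiable_rsubmx w)).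
  by apply: open_nbhs_nbhs; split=> //; exact: open_dom.
have FE k : F k = pd k (fun v => c 0 v *: y (rsubmx v) + (c 0 v * c 1 v) *: ys
  (rsubmx v)) w.
  rewrite /F !pdE; apply: near_eq_partial; apply: filterS near_w => v iv.
  by rewrite /in_chart4 /associate_surface ysE// /c !mxE.
have FE' k : F k = pd k (c 0) w *: y (rsubmx w) +
   c 0 w *: pd k (fun v => y (rsubmx v)) w +
   ((pd k (c 0) w * c 1 w + c 0 w * pd k (c 1) w) *: ys (rsubmx w)
    + (c 0 w * c 1 w) *: pd k (fun v => ys (rsubmx v)) w).
  rewrite FE pd_add; last 2 first.
  - exact: (differentiable_scale (dc _ _) (differentiable_rsubmx_comp dy)).
  - exact: (differentiable_scale (differentiable_mul (dc _ _) (dc _ _))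
      (differentiable_rsubmx_comp dysw)).
  rewrite (pd_scale k (dc 0 w) (differentiable_rsubmx_comp dy)).
  rewrite (pd_scale k (differentiable_mul (dc 0 w) (dc 1 w))
    (differentiable_rsubmx_comp dysw)).
  by rewrite (pd_mul k (dc 0 w) (dc 1 w)).
have [pdyl pdyr] := pd_rsubmx_comp dy; have [pdysl pdysr] := pd_rsubmx_comp dysw.
have cE j : c j w = lsubmx w 0 j by rewrite /c mxE.
have pd_cl j j' : pd (lshift 2 j) (c j') w = (j' == j)%:R.
  by rewrite pd_c mxE eq_lshift.
have pd_cr j j' : pd (rshift 2 j) (c j') w = 0.
  by rewrite pd_c mxE eq_lrshift andbF.
split=> [||k]; rewrite FE' ?pdyl ?pdysl ?pdyr ?pdysr ?pd_cl ?pd_cr !cE /=.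
- by rewrite !scaler0 !addr0 scale1r mul1r mulr0 addr0.
- by rewrite !scaler0 scale0r !add0r !addr0 mul0r add0r mulr1.
- by rewrite !mul0r mulr0 addr0 !scale0r !add0r scalerDr scalerA.
Qed.

Lemma gauss_partials i (w : 'rV[R]_(2 + 2)) :
  differentiable (gauss_map x n \o @param R M i) (rsubmx w) ->
  let Xi k := pd k (in_chart4 i (fun _ _ p => gauss_map x n p)) w in
  (forall j, Xi (lshift 2 j) = 0) /\
  (forall j, Xi (rshift 2 j) = pd j (gauss_map x n \o @param R M i) (rsubmx w)).
Proof. by move=> dxi; have := pd_rsubmx_comp dxi. Qed.

Let associate_in i : 'rV[R]_(2 + 2) -> R14 (R := R) := in_chart4 i
  (associate_surface x n).
Let gauss_in i : 'rV[R]_(2 + 2) -> R14 (R := R) :=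
  in_chart4 i (fun _ _ p => gauss_map x n p).

Let first_formE i w : first_form (@lorentz R) (associate_in i) w =
  \matrix_(a, b) lorentz (pd a (associate_in i) w) (pd b (associate_in i) w).
Proof. by rewrite /first_form; apply/matrixP => a b;
  rewrite [LHS]mxE [RHS]mxE !pdE. Qed.

Let second_formE i w : second_form (@lorentz R) (associate_in i) (gauss_in i) w =
  \matrix_(a, b) - lorentz (pd a (associate_in i) w) (pd b (gauss_in i) w).
Proof. by rewrite /second_form; apply/matrixP => a b;
  rewrite [LHS]mxE [RHS]mxE !pdE. Qed.

Lemma willmore_iff_associate_minimal : willmore x n <-> associate_minimal x n.
Proof.
have chartE i : exists ys : 'rV[R]_2 -> R14 (R := R),
    let y := fun u => (1, (x \o @param R M i) u) : R14 (R := R) in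
    [/\ forall u, dom i u -> differentiable ys u,
      forall u, dom i u -> differentiable (gauss_map x n \o @param R M i) u,
      forall u, dom i u -> dual_lift x n (param i u) = ys u &
      forall u, dom i u ->
        laplace_beltrami (surf_I x i) (surf_H x n \o @param R M i) u
        + tensor_norm2 (surf_I x i u) (surf_IIo x n i u) * surf_H x n (param i
          u) = 0 <->
        forall (alpha rho : R) (F Xi : 'I_(2 + 2) -> R14 (R := R)),
          0 < alpha -> 0 < rho ->
          F (lshift 2 0) = y u + rho *: ys u -> F (lshift 2 1) = alpha *: ys u ->
          (forall k, F (rshift 2 k) = alpha *: (pd k y u + rho *: pd k ys u)) ->
          (forall k, Xi (lshift 2 k) = 0) ->
          (forall k, Xi (rshift 2 k) = pd k (gauss_map x n \o @param R M i) u) ->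
          let g := \matrix_(i, j) lorentz (F i) (F j) in
          g \in unitmx ->
          \tr (invmx g *m \matrix_(i, j) - lorentz (F i) (Xi j)) = 0].
  have [ys [dys dual uniq eqv]] := chart_result i; exists ys; split=> [u iu|u iu|u iu|].
  - by have [] := dys u iu.
  - by have [] := dys u iu.
  - have [cone ysy ysxi ysxik] := dual u iu.
    by apply: dual_lift_chart => //; [move=> v /dys[]|move=> v *; exact: uniq].
  - exact: eqv.
split=> [W i w a0 r0 wi g h gu|minimal i u iu].
  have [ys [dys dxi dualE eqv]] := chartE i.
  have [F0 F1 F2] := associate_partials dualE dys wi.
  have [Xi1 Xi2] := gauss_partials (dxi _ wi).
  have := (eqv _ wi).1 (W i _ wi) _ _ (fun k => pd k (associate_in i) w)
    (fun k => pd k (gauss_in i) w) a0 r0 F0 F1 F2 Xi1 Xi2.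
  by rewrite /= -first_formE -second_formE; apply.
have [ys [dys dxi dualE eqv]] := chartE i.
apply/(eqv _ iu) => alpha rho F Xi a0 r0 F0 F1 F2 Xi1 Xi2 g gu.
(* The parameter point at which the prescribed [F] and [Xi] are the actual partial derivatives of
   the 4-surface and of its normal. *)
pose w : 'rV[R]_(2 + 2) := row_mx (\row_j (if j == 0 then alpha else rho)) u.
have wr : rsubmx w = u by rewrite row_mxKr.
have w0 : lsubmx w 0 0 = alpha by rewrite row_mxKl mxE.
have w1 : lsubmx w 0 1 = rho by rewrite row_mxKl mxE.
have wi : dom i (rsubmx w) by rewrite wr.
have [G0 G1 G2] := associate_partials dualE dys wi.
have [Y1 Y2] := gauss_partials (dxi _ wi).
rewrite wr w0 w1 in G0 G1 G2; rewrite wr in Y2.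
have FE k : F k = pd k (associate_in i) w.
  rewrite -[k]splitK; case: (fintype.split k) => {}k /=; last by rewrite F2 -G2.
  by move: k; apply: ord2P; [rewrite F0 -G0|rewrite F1 -G1].
have XiE k : Xi k = pd k (gauss_in i) w.
  rewrite -[k]splitK; case: (fintype.split k) => {}k /=; last by rewrite Xi2 -Y2.
  by rewrite Xi1; exact: esym (Y1 k).
have gE : g = first_form (@lorentz R) (associate_in i) w.
  by rewrite first_formE; apply/matrixP => a b; rewrite [LHS]mxE [RHS]mxE !FE.
have hE : \matrix_(a, b) - lorentz (F a) (Xi b) =
    second_form (@lorentz R) (associate_in i) (gauss_in i) w.
  by rewrite second_formE; apply/matrixP => a b; rewrite [LHS]mxE [RHS]mxE FE XiE.
rewrite hE gE; rewrite gE in gu.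
by apply: (minimal i w); rewrite ?w0 ?w1.
Qed.

End Global.

Theorem theorem3p2p1 (R : realType) (M : surface R) (x n : M -> 'rV[R]_4)
  (x_immersion : immersion_S3 x) (n_normal : unit_normal x n)
  (no_umbilic : forall p : M, ~ umbilical x n p) :
  willmore x n <-> associate_minimal x n.
Proof. exact: willmore_iff_associate_minimal. Qed.
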